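(* For every integer $n \geq 8$, there exists an Artinian Gorenstein local ring $S_n$ with $h$-vector $(1,n,n,1)$ that is not generalized Golod. In particular, for every integer $m \geq 18$, there exists an Artinian Gorenstein local ring of multiplicity $m$ that fails to be generalized Golod.
   Context: All rings are commutative Noetherian local rings with $1 \neq 0$. For an Artinian local ring $(R,\mathfrak m,k)$ the $h$-vector is the sequence $(\dim_k \mathfrak m^i/\mathfrak m^{i+1})_{i\ge 0}$ (up to the last nonzero entry) and the multiplicity is the length of $R$. **Acyclic closure.** For a local ring $(R,\mathfrak m,k)$, the acyclic closure (Tate resolution of $k$) is the DG algebra with divided powers (DG$\Gamma$ algebra) $R\langle X\rangle$, $X=\{X_i\}_{i\ge 1}$, obtained from $R$ by successively adjoining $\Gamma$-variables (exterior variables in odd degree, divided power variables in even positive degree): the differential $\partial$ sends the degree $1$ variables to a minimal generating set of $\mathfrak m$, and for each $n \ge 1$ it sends the variables of degree $n+1$ to cycles whose classes minimally generate $H_n(R\langle X_i : \deg X_i \le n\rangle)$. The DG$\Gamma$ algebras $R\langle X_i : \deg X_i \le n\rangle$, $n \ge 1$, are called partial acyclic closures. **Golod algebra.** Let $A$ be a DG$\Gamma$ algebra over $R$ that is minimal ($\partial(A)\subseteq \mathfrak m A$), with $H_0(A)=k$, cycles satisfying $Z_{\ge 1}(A)\subseteq \mathfrak m A$, and each $A_i$ free of finite rank over $R$. $A$ is a Golod algebra if it admits a trivial Massey operation: there are a graded $k$-basis $\mathfrak b=\{h_\lambda\}_{\lambda\in\Lambda}$ of $H_{\ge 1}(A)$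 and a function $\mu : \bigsqcup_{i\ge 1}\mathfrak b^i \to A$ such that $\mu(h_\lambda)$ is a cycle with class $h_\lambda$ and, with $\bar a = (-1)^{i+1}a$ for $a\in A_i$, $\partial\mu(h_{\lambda_1},\dots,h_{\lambda_p}) = \sum_{j=1}^{p-1}\overline{\mu(h_{\lambda_1},\dots,h_{\lambda_j})}\,\mu(h_{\lambda_{j+1}},\dots,h_{\lambda_p})$. Equivalently, $P^R_k(t) = \dfrac{H_{A\otimes_R k}(t)}{1-t(H_{H(A)}(t)-1)}$, where $P^R_k(t)=\sum_i \dim_k\operatorname{Tor}^R_i(k,k)t^i$ and $H_{-}(t)$ denotes the Hilbert series of a graded $k$-vector space. **Generalized Golod ring.** $R$ is a generalized Golod ring of level $n$ if the partial acyclic closure $R\langle X_i : \deg X_i \le n\rangle$ is a Golod algebra; equivalently, $\pi^{>n}(R)$ is a free graded Lie algebra, where $\pi(R)$ is the homotopy Lie algebra of $R$ (the graded Lie algebra over $k$ whose universal enveloping algebra is the graded dual of the Hopf algebra $\operatorname{Tor}^R(k,k)$). $R$ is generalized Golod if it is a generalized Golod ring of level $n$ for some $n \ge 1$. *)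

(* Defs.v *)
From HB Require Import structures.
From mathcomp Require Import all_boot all_order all_algebra.
From mathcomp Require Import boolp classical_sets.

Set Implicit Arguments.
Unset Strict Implicit.
Unset Printing Implicit Defensive.

Import GRing.Theory.

Local Open Scope classical_set_scope.
Local Open Scope ring_scope.

Section Ideals.
Variable R : comNzRingType.
Implicit Types (I J m : set R).

Definition is_ideal I : Prop :=
  [/\ I 0, (forall x y, I x -> I y -> I (x + y)) &
      (forall r x, I x -> I (r * x))].

Definition is_maximal_ideal I : Prop :=
  [/\ is_ideal I, ~ I 1 &
      forall J, is_ideal J -> ~ J 1 -> I `<=` J -> J = I].

Definition is_local m : Prop :=
  is_maximal_ideal m /\ forall I, is_maximal_ideal I -> I = m.

Definition noetherian : Prop :=
  forall I, is_ideal I ->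
  exists (p : nat) (g : 'I_p -> R),
    I = [set x | exists r : 'I_p -> R, x = \sum_i r i * g i].

Definition artinian : Prop :=
  forall I : nat -> set R,
    (forall i, is_ideal (I i)) -> (forall i, I i.+1 `<=` I i) ->
  exists p, forall i, (p <= i)%N -> I i = I p.

Definition ideal_mul I J : set R :=
  [set x | exists (p : nat) (a b : 'I_p -> R),
     (forall i, I (a i) /\ J (b i)) /\ x = \sum_i a i * b i].

Fixpoint ideal_exp I (i : nat) : set R :=
  if i is j.+1 then ideal_mul I (ideal_exp I j) else setT.

(* R has a composition series of ideals with l simple factors. *)
Definition has_length (l : nat) : Prop :=
  exists I : nat -> set R,
    [/\ I 0%N = [set 0], I l = setT, (forall j, is_ideal (I j)) &
        forall j, (j < l)%N ->
          [/\ I j `<=` I j.+1, I j <> I j.+1 &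
              forall J, is_ideal J -> I j `<=` J -> J `<=` I j.+1 ->
                J = I j \/ J = I j.+1]].

End Ideals.

Arguments noetherian : clear implicits.
Arguments artinian : clear implicits.
Arguments has_length : clear implicits.

Section Modules.
Variables (R : comNzRingType) (V : lmodType R).
Implicit Types (M B : set V).

(* For submodules B <= M of V and an ideal K with K M <= B: the classes of the
   e l, for l in P, form a basis of M / B over R / K.  The case K = 0 and
   B = 0 is that of an R-basis of M. *)
Definition is_basis_mod (K : set R) M B (L : choiceType) (P : pred L)
    (e : L -> V) : Prop :=
  [/\ forall l, P l -> M (e l),
      forall x, M x -> exists (s : seq L) (r : L -> R),
        all P s /\ B (x - \sum_(l <- s) r l *: e l) &
      forall (s : seq L) (r : L -> R), uniq s -> all P s ->
        B (\sum_(l <- s) r l *: e l) -> forall l, l \in s -> K (r l)].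

Definition has_dim_mod (K : set R) M B (d : nat) : Prop :=
  exists e : 'I_d -> V, is_basis_mod K M B xpredT e.

Definition generate_mod M B (T : finType) (P : pred T) (g : T -> V) : Prop :=
  (forall i, P i -> M (g i)) /\
  forall z, M z -> exists r : T -> R, B (z - \sum_(i | P i) r i *: g i).

Definition minimally_generate_mod M B (T : finType) (P : pred T) (g : T -> V) :
    Prop :=
  generate_mod M B P g /\
  forall Q : pred T, (forall i, Q i -> P i) -> generate_mod M B Q g ->
    forall i, P i -> Q i.

(* The submodule K V. *)
Definition scale_ideal (K : set R) : set V :=
  [set x | exists (p : nat) (r : 'I_p -> R) (v : 'I_p -> V),
     (forall i, K (r i)) /\ x = \sum_i r i *: v i].

End Modules.

Section Gorenstein.
Variable R : comNzRingType.

Definition injective_module (E : lmodType R) : Prop :=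
  forall (U V : lmodType R) (i : {linear U -> V}) (f : {linear U -> E}),
    injective i -> exists g : {linear V -> E}, forall u, g (i u) = f u.

(* The step case is a short exact sequence 0 -> M -> E -> C -> 0 with E
   injective. *)
Fixpoint injdim_le (d : nat) (M : lmodType R) : Prop :=
  if d is d'.+1 then
    exists (E C : lmodType R) (i : {linear M -> E}) (p : {linear E -> C}),
      [/\ injective_module E,
          injective i, (forall c, exists x, p x = c),
          (forall x, p x = 0 <-> exists y, i y = x) &
          injdim_le d' C]
  else injective_module M.

Definition gorenstein : Prop := exists d, injdim_le d R^o.

End Gorenstein.

Arguments gorenstein : clear implicits.

Definition artinian_gorenstein_local (R : comNzRingType) (m : set R) : Prop :=
  [/\ noetherian R, is_local m, artinian R & gorenstein R].

Definition has_hvector (R : comNzRingType) (m : set R) (h : seq nat) : Prop :=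
  (forall i, @has_dim_mod R R^o m (ideal_exp m i) (ideal_exp m i.+1)
               (nth 0%N h i)) /\
  last 0%N h != 0%N.

(* A DG algebra with divided powers, graded by nat, with differential of degree
   -1.  The field dg_dpow i x is the i-th divided power of x and is meaningful
   only for x homogeneous of even positive degree. *)
Record dgGammaAlgebra (R : comNzRingType) := DGGammaAlgebra {
  dg_sort :> algType R;
  dg_hom : nat -> set dg_sort;
  dg_d : {linear dg_sort -> dg_sort};
  dg_dpow : nat -> dg_sort -> dg_sort;

  dg_hom0 : forall i, dg_hom i 0;
  dg_homD : forall i x y, dg_hom i x -> dg_hom i y -> dg_hom i (x + y);
  dg_homZ : forall i (r : R) x, dg_hom i x -> dg_hom i (r *: x);
  dg_hom_span : forall x, exists (p : nat) (c : nat -> dg_sort),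
    (forall i, dg_hom i (c i)) /\ x = \sum_(i < p) c i;
  dg_hom_direct : forall (p : nat) (c : nat -> dg_sort),
    (forall i, dg_hom i (c i)) -> \sum_(i < p) c i = 0 ->
    forall i, (i < p)%N -> c i = 0;
  dg_hom1 : dg_hom 0%N 1;
  dg_homM : forall i j x y,
    dg_hom i x -> dg_hom j y -> dg_hom (i + j)%N (x * y);

  dg_mulC : forall i j x y, dg_hom i x -> dg_hom j y ->
    x * y = (-1) ^+ (i * j)%N * (y * x);
  dg_sqr_odd : forall i x, odd i -> dg_hom i x -> x * x = 0;

  dg_d_hom0 : forall x, dg_hom 0%N x -> dg_d x = 0;
  dg_d_homS : forall i x, dg_hom i.+1 x -> dg_hom i (dg_d x);
  dg_dd : forall x, dg_d (dg_d x) = 0;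
  dg_leibniz : forall i x y, dg_hom i x ->
    dg_d (x * y) = dg_d x * y + (-1) ^+ i * (x * dg_d y);

  dg_dpow0 : forall k x, ~~ odd k -> (0 < k)%N -> dg_hom k x ->
    dg_dpow 0%N x = 1;
  dg_dpow1 : forall k x, ~~ odd k -> (0 < k)%N -> dg_hom k x ->
    dg_dpow 1%N x = x;
  dg_dpow_hom : forall k i x, ~~ odd k -> (0 < k)%N -> dg_hom k x ->
    dg_hom (i * k)%N (dg_dpow i x);
  dg_dpow_mul : forall k i j x, ~~ odd k -> (0 < k)%N -> dg_hom k x ->
    dg_dpow i x * dg_dpow j x = dg_dpow (i + j)%N x *+ 'C(i + j, i);
  dg_dpowD : forall k i x y, ~~ odd k -> (0 < k)%N ->
    dg_hom k x -> dg_hom k y ->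
    dg_dpow i (x + y) = \sum_(j < i.+1) dg_dpow j x * dg_dpow (i - j)%N y;
  dg_dpowM_even : forall k l i x y, ~~ odd k -> ~~ odd l -> (0 < l)%N ->
    dg_hom k x -> dg_hom l y -> dg_dpow i (x * y) = x ^+ i * dg_dpow i y;
  dg_dpowM_odd : forall k l i x y, odd k -> odd l -> (1 < i)%N ->
    dg_hom k x -> dg_hom l y -> dg_dpow i (x * y) = 0;
  dg_dpow_comp : forall k i j x, ~~ odd k -> (0 < k)%N -> (0 < i)%N ->
    dg_hom k x ->
    dg_dpow j (dg_dpow i x)
      = dg_dpow (i * j)%N x *+ ((i * j)`! %/ (j`! * i`! ^ j))%N;
  dg_d_dpow : forall k i x, ~~ odd k -> (0 < k)%N -> dg_hom k x ->
    dg_d (dg_dpow i.+1 x) = dg_d x * dg_dpow i x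
}.

Arguments dg_hom {R A} i x : rename.
Arguments dg_d {R A} : rename.
Arguments dg_dpow {R A} i x : rename.

Section AcyclicClosure.
Variables (R : comNzRingType) (m : set R) (A : dgGammaAlgebra R).
Variables (N : nat) (deg : 'I_N -> nat) (X : 'I_N -> A).

(* Exponents of the normal monomials in variables of degree <= q: odd variables
   occur at most once. *)
Definition gamma_exponent (q : nat) (a : {ffun 'I_N -> nat}) : bool :=
  [forall i, (odd (deg i) ==> (a i <= 1)%N)
             && ((q < deg i)%N ==> (a i == 0%N))].

Definition gamma_monomial (a : {ffun 'I_N -> nat}) : A :=
  \prod_(i < N) (if odd (deg i) then X i ^+ a i else dg_dpow (a i) (X i)).

(* The subalgebra R<X_i : deg X_i <= q>. *)
Definition gamma_sub (q : nat) : set A :=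
  [set x | exists (s : seq {ffun 'I_N -> nat}) (r : {ffun 'I_N -> nat} -> R),
     all (gamma_exponent q) s /\ x = \sum_(a <- s) r a *: gamma_monomial a].

(* A = R<X> is the partial acyclic closure R<X_i : deg X_i <= n>; it has
   finitely many variables because R is Noetherian.  The third clause reads
   dg_d (X i) in A_0 = R; in the fourth, dg_d (X i) for deg X_i = q + 1 ranges
   over cycles of R<X_i : deg X_i <= q> whose classes minimally generate its
   q-th homology. *)
Definition is_partial_acyclic_closure (n : nat) : Prop :=
  [/\ forall i, (0 < deg i <= n)%N /\ dg_hom (deg i) (X i),
      is_basis_mod [set 0] setT [set 0] (gamma_exponent n) gamma_monomial,
      exists f : 'I_N -> R,
        (forall i, deg i = 1%N -> dg_d (X i) = (f i)%:A) /\
        @minimally_generate_mod R R^o m [set 0] _ [pred i | deg i == 1%N] f &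
      forall q, (0 < q < n)%N ->
        minimally_generate_mod
          [set z : A | [/\ gamma_sub q z, dg_hom q z & dg_d z = 0]]
          [set z : A | exists b : A,
             [/\ gamma_sub q b, dg_hom q.+1 b & z = dg_d b]]
          [pred i | deg i == q.+1] (fun i => dg_d (X i))].

End AcyclicClosure.

Section Golod.
Variables (R : comNzRingType) (m : set R) (A : dgGammaAlgebra R).

Definition cycles (i : nat) : set A := [set z | dg_hom i z /\ dg_d z = 0].

Definition boundaries : set A := [set z | exists b, z = dg_d b].

(* H_0(A) = k as R-algebras: R -> H_0(A) is onto with kernel m. *)
Definition H0_residue_field : Prop :=
  (forall x : A, dg_hom 0%N x -> exists r : R, boundaries (x - r%:A)) /\
  forall r : R, boundaries (r%:A : A) <-> m r.

(* The homogeneous basis element of H_{>= 1}(A) indexed by l is the class of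
   the cycle h l, of degree dl l, and mu (l_1, ..., l_p) is the value of the
   operation at the corresponding classes; its value at the empty sequence is
   irrelevant.  As A is spanned by homogeneous elements, bar is the unique
   linear map with the prescribed values. *)
Definition has_trivial_massey : Prop :=
  exists (L : choiceType) (dl : L -> nat) (h : L -> A) (mu : seq L -> A)
         (bar : {linear A -> A}),
    [/\ forall l, (0 < dl l)%N,
        forall i, (0 < i)%N ->
          is_basis_mod m (cycles i) boundaries [pred l | dl l == i] h,
        forall l, dg_d (mu [:: l]) = 0 /\ boundaries (mu [:: l] - h l),
        forall i a, dg_hom i a -> bar a = (-1) ^+ i.+1 *: a &
        forall s : seq L, (0 < size s)%N ->
          dg_d (mu s)
          = \sum_(1 <= j < size s) bar (mu (take j s)) * mu (drop j s)].

Definition is_golod_algebra : Prop :=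
  [/\ [/\ forall x : A, scale_ideal m (dg_d x),
          H0_residue_field,
          forall i z, (0 < i)%N -> cycles i z -> scale_ideal m z &
          forall i, exists d, has_dim_mod [set 0] (dg_hom i : set A) [set 0] d] &
      has_trivial_massey].

End Golod.

(* Acyclic closures are unique up to isomorphism of DG algebras with divided
   powers, so it is immaterial which one is used. *)
Definition generalized_golod_of_level (R : comNzRingType) (m : set R) (n : nat) :
    Prop :=
  exists (A : dgGammaAlgebra R) (N : nat) (deg : 'I_N -> nat) (X : 'I_N -> A),
    is_partial_acyclic_closure m deg X n /\ is_golod_algebra m A.

Definition generalized_golod (R : comNzRingType) (m : set R) : Prop :=
  exists n, (1 <= n)%N /\ generalized_golod_of_level m n.

(* Main.v *)
(* Work over k = F_2.  Let T = k[X, Z]/((X)^2 + (Z)^2) with X = (x1, x2) and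
   Z = (z1, z2), and let S be the Gorenstein ring of the cubic form
   sum x_i z_j p_ij + sum y_l^3, possibly with squares w_j^2 added to the socle
   to adjust the length.  T is a quotient of S, and x_i x_j = z_i z_j = 0 in S.

   The Tate resolution D of k over T is explicit: it is T tensored with the
   shuffle algebras on the letters X and on the letters Z, and it carries an
   explicit contraction.  Its homotopy Lie algebra is the product of two free
   Lie algebras: stripping letters from the right ends of the words gives
   derivations of D that commute with the differential, and those coming from X
   commute with those coming from Z.

   Let A be the partial acyclic closure of S of level n.  Acyclicity of D yields
   a morphism phi : A -> D compatible with divided powers; A is generated in
   degrees <= n, so chain derivations a, b of degree -(n+1), coming from
   (ad x1)^n x2 and (ad z1)^n z2, vanish on phi(A).  Since A is exact in degrees
   0 < q < n, the words in X and in Z give cycles z, z' of degree n in A with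
   phi z = d t and phi z' = d t', where a t = 1 and b t' = 1 modulo the maximal
   ideal, but b t = 0.  A trivial Massey operation makes z z' a boundary d w;
   then phi w + t d t' is a cycle of D, hence bounds some v, and a b v = 0 while
   b a v = 1 modulo the maximal ideal, contradicting a b = b a. *)

Require Import Defs.
From HB Require Import structures.
From mathcomp Require Import all_boot all_order all_algebra.
From mathcomp Require Import boolp classical_sets.
From mathcomp Require Import ring zify.

Set Implicit Arguments.
Unset Strict Implicit.
Unset Printing Implicit Defensive.

Import GRing.Theory.

Local Open Scope classical_set_scope.
Local Open Scope ring_scope.

(** * Shuffle algebras *)

(* B[x, y]/(x, y)^2, where (b, (c, d)) stands for b + c x + d y. *)
Definition ext (B : comNzRingType) : Type := (B * (B * B))%type.

Section Ext.
Variable B : comNzRingType.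
HB.instance Definition _ := GRing.Zmodule.copy (ext B) (B * (B * B))%type.
Implicit Types f g h : ext B.

Definition ext_one : ext B := (1, (0, 0)).
Definition ext_mul f g : ext B :=
  (f.1 * g.1, (f.1 * g.2.1 + f.2.1 * g.1, f.1 * g.2.2 + f.2.2 * g.1)).

Lemma ext_eqP f g :
  f.1 = g.1 -> f.2.1 = g.2.1 -> f.2.2 = g.2.2 -> f = g.
Proof. by case: f => ? [? ?]; case: g => ? [? ?] /= -> -> ->. Qed.

Fact ext_mulA : associative ext_mul.
Proof. by move=> f g h; apply: ext_eqP => /=; ring. Qed.
Fact ext_mulC : commutative ext_mul.
Proof. by move=> f g; apply: ext_eqP => /=; ring. Qed.
Fact ext_mul1 : left_id ext_one ext_mul.
Proof. by move=> f; apply: ext_eqP => /=; ring. Qed.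
Fact ext_mulD : left_distributive ext_mul +%R.
Proof. by move=> f g h; apply: ext_eqP => /=; ring. Qed.
Fact ext_one_neq0 : ext_one != 0.
Proof. by apply/eqP => -[] /eqP; rewrite oner_eq0. Qed.

HB.instance Definition _ := GRing.Zmodule_isComNzRing.Build (ext B)
  ext_mulA ext_mulC ext_mul1 ext_mulD ext_one_neq0.
End Ext.

(* Functionals on words in two letters.  The shuffle product is the one for
   which the left strips, dual to the left multiplications by the letters, are
   derivations; no signs are needed in characteristic 2. *)
Definition shuf (B : comNzRingType) : Type := seq bool -> B.

Section Shuffle.
Variable B : comNzRingType.
Implicit Types (f g h : shuf B) (v : bool) (w : seq bool).

HB.instance Definition _ := gen_eqMixin (shuf B).
HB.instance Definition _ := gen_choiceMixin (shuf B).

Definition shuf_add f g : shuf B := fun w => f w + g w.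
Fact shuf_addA : associative shuf_add.
Proof. by move=> f g h; apply: funext => w; apply: addrA. Qed.
Fact shuf_addC : commutative shuf_add.
Proof. by move=> f g; apply: funext => w; apply: addrC. Qed.
Fact shuf_add0 : left_id (fun=> 0) shuf_add.
Proof. by move=> f; apply: funext => w; apply: add0r. Qed.
Fact shuf_addN : left_inverse (fun=> 0) (fun f w => - f w) shuf_add.
Proof. by move=> f; apply: funext => w; apply: addNr. Qed.
HB.instance Definition _ := GRing.isZmodule.Build (shuf B)
  shuf_addA shuf_addC shuf_add0 shuf_addN.

Definition lstrip v f : shuf B := fun w => f (v :: w).
Definition rstrip v f : shuf B := fun w => f (rcons w v).

Fixpoint shuf_mul_rec f g w : B :=
  if w is v :: w' then
    shuf_mul_rec (lstrip v f) g w' + shuf_mul_rec f (lstrip v g) w'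
  else f [::] * g [::].
Definition shuf_mul f g : shuf B := shuf_mul_rec f g.
Definition shuf_const (b : B) : shuf B := fun w => if w is [::] then b else 0.

Lemma shuf_mul_cons f g v w : shuf_mul f g (v :: w)
  = shuf_mul (lstrip v f) g w + shuf_mul f (lstrip v g) w.
Proof. by []. Qed.

Lemma lstrip_shuf_mul v f g : lstrip v (shuf_mul f g)
  = shuf_mul (lstrip v f) g + shuf_mul f (lstrip v g).
Proof. by []. Qed.

Lemma shufDE f g w : (f + g) w = f w + g w.
Proof. by []. Qed.

Fact shuf_mulC : commutative shuf_mul.
Proof.
move=> f g; apply: funext => w.
elim: w f g => [|v w IH] f g; first exact: mulrC.
by rewrite !shuf_mul_cons addrC IH [in X in _ + X]IH.
Qed.

Fact shuf_mulD : left_distributive shuf_mul +%R.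
Proof.
move=> f g h; apply: funext => w.
elim: w f g h => [|v w IH] f g h; first exact: mulrDl.
rewrite shufDE !shuf_mul_cons (_ : lstrip v (f + g) = lstrip v f + lstrip v g) //.
by rewrite !IH !shufDE addrACA.
Qed.

Fact shuf_mulA : associative shuf_mul.
Proof.
move=> f g h; apply: funext => w.
elim: w f g h => [|v w IH] f g h; first exact: mulrA.
rewrite !shuf_mul_cons !lstrip_shuf_mul shuf_mulD.
by rewrite (shuf_mulC f) shuf_mulD !(shuf_mulC _ f) !shufDE !IH addrA.
Qed.

Fact shuf_mul1 : left_id (shuf_const 1) shuf_mul.
Proof.
have Z w f : shuf_mul 0 f w = 0.
  elim: w f => [|v w IH] f; first exact: mul0r.
  by rewrite shuf_mul_cons (_ : lstrip v 0 = 0) // !IH addr0.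
move=> f; apply: funext => w.
elim: w f => [|v w IH] f; first exact: mul1r.
by rewrite shuf_mul_cons (_ : lstrip v (shuf_const 1) = 0) // Z IH add0r.
Qed.

Fact shuf_one_neq0 : shuf_const 1 != 0.
Proof.
by apply/eqP => /(congr1 (fun f : shuf B => f [::])) /eqP; rewrite oner_eq0.
Qed.

HB.instance Definition _ := GRing.Zmodule_isComNzRing.Build (shuf B)
  shuf_mulA shuf_mulC shuf_mul1 shuf_mulD shuf_one_neq0.
End Shuffle.

(** The divided power rule is imposed only on the augmentation ideal, where [gp] is meaningful. The
    product rule carries no sign because it is applied in characteristic 2. *)
Definition gamma_derivation (B : comNzRingType) (eps : B -> bool)
    (gp : B -> nat -> B) (t : B -> B) : Prop :=
  [/\ forall x y, t (x + y) = t x + t y,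
      forall x y, t (x * y) = t x * y + x * t y &
      forall y i, eps y = false -> t (gp y i.+1) = t y * gp y i].

Section GammaDerivation.
Variables (B : comNzRingType) (eps : B -> bool) (gp : B -> nat -> B).
Implicit Types (t u : B -> B).
Local Notation gder := (gamma_derivation eps gp).

Lemma gder0 t : gder t -> t 0 = 0.
Proof. by move=> [D _ _]; apply: (addrI (t 0)); rewrite -D !addr0. Qed.

Lemma gder1 t : gder t -> t 1 = 0.
Proof.
move=> [_ M _]; apply: (addrI (t 1)).
by rewrite addr0 -[in RHS](mulr1 1) M mulr1 mul1r.
Qed.

Lemma gder_add t u : gder t -> gder u -> gder (fun x => t x + u x).
Proof.
move=> [tD tM tG] [uD uM uG]; split=> [x y|x y|y i ey].
- by rewrite tD uD addrACA.
- by rewrite tM uM; ring.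
- by rewrite tG // uG // mulrDl.
Qed.

Lemma gder_mull b t : gder t -> gder (fun x => b * t x).
Proof.
move=> [tD tM tG]; split=> [x y|x y|y i ey].
- by rewrite tD mulrDr.
- by rewrite tM; ring.
- by rewrite tG // mulrA.
Qed.

(** In characteristic 2 the sum of the two composites is the graded commutator. The cross terms
    [t x * u y] and [u x * t y] arise twice and cancel, and so does the second-order term
    [u y * (t y * gp y i)] of the divided power rule. *)
Lemma gder_commutator t u : (forall x : B, x + x = 0) ->
  (forall y, eps y = false -> gp y 0 = 1) ->
  gder t -> gder u -> gder (fun x => t (u x) + u (t x)).
Proof.
move=> two gp0 dt du; have [tD tM tG] := dt; have [uD uM uG] := du.
have c2 (a b : B) : a + b + b = a by rewrite -addrA two addr0.
split=> [x y|x y|y i ey].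
- by rewrite uD !tD uD addrACA.
- rewrite uM !(tD, tM, uD, uM) -[RHS](c2 _ (t x * u y + u x * t y)); ring.
- rewrite uG // tM tG // uM; case: i => [|i].
    by rewrite gp0 // (gder1 dt) (gder1 du); ring.
  rewrite tG // uG // -[RHS](c2 _ (u y * (t y * gp y i))); ring.
Qed.

End GammaDerivation.

(** * Tate models *)

(* [eps] is the augmentation onto F_2, [fil p] consists of the elements of
   degree < p, and [gp y i] is the i-th divided power of y in Ker eps. *)
Record tate_model := TateModel {
  tm_ring :> comNzRingType;
  tm_d : tm_ring -> tm_ring;
  tm_s : tm_ring -> tm_ring;
  tm_eps : tm_ring -> bool;
  tm_fil : nat -> tm_ring -> Prop;
  tm_gp : tm_ring -> nat -> tm_ring;

  tm_two : forall x : tm_ring, x + x = 0;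
  tm_epsD : forall x y, tm_eps (x + y) = tm_eps x (+) tm_eps y;
  tm_epsM : forall x y, tm_eps (x * y) = tm_eps x && tm_eps y;
  tm_eps1 : tm_eps 1;

  tm_fil_eq0 : forall x, tm_fil 0 x -> x = 0;
  tm_fil0 : forall p, tm_fil p 0;
  tm_fil1 : tm_fil 1 1;
  tm_filS : forall p x, tm_fil p x -> tm_fil p.+1 x;
  tm_filD : forall p x y, tm_fil p x -> tm_fil p y -> tm_fil p (x + y);
  tm_filM : forall p q x y, tm_fil p.+1 x -> tm_fil q.+1 y ->
    tm_fil (p + q).+1 (x * y);

  tm_gp0 : forall y, tm_eps y = false -> tm_gp y 0 = 1;
  tm_gp1 : forall y, tm_eps y = false -> tm_gp y 1 = y;
  tm_gpM : forall y i j, tm_eps y = false ->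
    tm_gp y i * tm_gp y j = tm_gp y (i + j)%N *+ 'C(i + j, i);
  tm_eps_gp : forall y i, tm_eps y = false -> tm_eps (tm_gp y i.+1) = false;
  tm_fil_gp : forall p y i, tm_eps y = false -> tm_fil p.+1 y ->
    tm_fil (i * p).+1 (tm_gp y i);

  tm_d_gder : gamma_derivation tm_eps tm_gp tm_d;
  tm_dd : forall x, tm_d (tm_d x) = 0;
  tm_eps_d : forall x, tm_eps (tm_d x) = false;
  tm_fil_d : forall p x, tm_fil p.+1 x -> tm_fil p (tm_d x);
  tm_eps_s : forall x, tm_eps (tm_s x) = false;
  tm_fil_s : forall p x, tm_fil p x -> tm_fil p.+1 (tm_s x);
  tm_homotopy : forall x, tm_d (tm_s x) + tm_s (tm_d x) = x + (tm_eps x)%:R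
}.

Lemma mulrn_addb (B : comNzRingType) : (forall x : B, x + x = 0) ->
  forall b c : bool, (b (+) c)%:R = b%:R + c%:R :> B.
Proof. by move=> two [] [] //=; rewrite ?addr0 ?add0r // two. Qed.

Section Bool.
Let bgp (y : bool) i : bool := i == 0%N.
Fact bool_gpM (y : bool) i j : y = false ->
  bgp y i * bgp y j = bgp y (i + j)%N *+ 'C(i + j, i).
Proof.
rewrite /bgp; case: i => [|i] _; first by rewrite bin0 mul1r.
by case: j => [|j] /=; rewrite mul0rn.
Qed.
Fact bool_d_gder : gamma_derivation (@id bool) bgp (fun=> 0).
Proof. by split=> [x y|x y|y i] *; rewrite ?mul0r ?mulr0 ?addr0. Qed.

(** F_2 in degree 0, the base of the two steps that build the Tate resolution. As Ker [eps] is 0,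
    only the divided powers of 0 matter. *)
Definition bool_model : tate_model.
Proof.
refine (@TateModel bool (fun=> 0) (fun=> 0) id (fun p x => p = 0%N -> x = 0)
  bgp _ _ _ _ _ _ _ _ _ _ _ _ bool_gpM _ _ bool_d_gder _ _ _ _ _ _) => //.
- by case.
- by move=> x; apply.
- by move=> p x y Hx Hy p0; rewrite Hx ?Hy.
- by case.
Defined.
End Bool.

(** * Adjoining the Tate resolution of k[x, y]/(x, y)^2 *)

Section ShuffleTheory.
Variable B : comNzRingType.
Implicit Types (f g h : shuf B) (v : bool) (w : seq bool).

Lemma shufME f g w : (f * g) w = shuf_mul f g w. Proof. by []. Qed.

Lemma shufM_cons f g v w :
  (f * g) (v :: w) = (lstrip v f * g) w + (f * lstrip v g) w.
Proof. by []. Qed.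

Lemma shuf_const0 w : shuf_const 0 w = 0 :> B.
Proof. by case: w. Qed.

Lemma shuf_constM c f w : (shuf_const c * f) w = c * f w.
Proof.
elim: w f => [//|v w IH] f.
by rewrite shufM_cons IH (_ : lstrip v (shuf_const c) = 0) // mul0r add0r.
Qed.

(** Left and right strips commute, so the product rule passes from [w] to [u :: w]. *)
Lemma rstripM v f g : rstrip v (f * g) = rstrip v f * g + f * rstrip v g.
Proof.
apply: funext => w; elim: w f g => [|u w IH] f g //.
rewrite /rstrip /= shufM_cons [RHS]shufDE !shufM_cons.
rewrite -!/(rstrip _ _ _) !IH !shufDE; ring.
Qed.

Definition shuf_map (t : B -> B) f : shuf B := fun w => t (f w).

Lemma shuf_mapM t : (forall x y, t (x + y) = t x + t y) ->
  (forall x y, t (x * y) = t x * y + x * t y) ->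
  forall f g, shuf_map t (f * g) = shuf_map t f * g + f * shuf_map t g.
Proof.
move=> tD tM f g; apply: funext => w; rewrite shufDE.
elim: w f g => [|u w IH] f g; first exact: tM.
rewrite (_ : shuf_map t (f * g) (u :: w) = shuf_map t (lstrip u f * g) w
  + shuf_map t (f * lstrip u g) w); last exact: tD.
rewrite !IH !shufM_cons.
have L h : lstrip u (shuf_map t h) = shuf_map t (lstrip u h) by [].
by rewrite !L; ring.
Qed.
End ShuffleTheory.

Section ExtMap.
Variable (B : comNzRingType) (t : B -> B).
Definition ext_map (f : ext B) : ext B := (t f.1, (t f.2.1, t f.2.2)).
End ExtMap.

Section Step.
Variable M : tate_model.
Local Notation C := (shuf (ext M)).
Implicit Types (f g h : C) (v : bool) (w : seq bool).

(** The expansion (b + c x + d y)^(i) = b^(i) + b^(i-1) (c x + d y); further terms would contain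
    products of x and y, which vanish. *)
Definition ext_gp (f : ext M) i : ext M :=
  if i is i'.+1 then
    (tm_gp f.1 i, (tm_gp f.1 i' * f.2.1, tm_gp f.1 i' * f.2.2))
  else 1.

(** The recursion forces the left strips to satisfy the divided power rule; on the empty word the
    divided powers of [ext M] are used. *)
Fixpoint step_gp f i : C :=
  if i is i'.+1 then
    fun w => if w is v :: w' then (lstrip v f * step_gp f i') w'
             else ext_gp (f [::]) i
  else 1.

Definition step_eps f : bool := tm_eps (f [::]).1.

Definition step_var v : C := shuf_const (0, (v%:R, (~~ v)%:R)).

(** The differential of [M] on coefficients, plus the rule that replaces the first letter of a word
    by the corresponding ring variable. *)
Definition step_d f : C :=
  shuf_map (ext_map (@tm_d M)) f
  + step_var true * lstrip true f + step_var false * lstrip false f.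

(** The contraction turns a ring variable in front of a word into its first letter. The constant
    coefficient at the empty word is left to the contraction of [M]. *)
Definition step_s f : C := fun w =>
  match w with
  | [::] => (tm_s (f [::]).1, (0, 0))
  | v :: w' => (if v then (f w').2.1 else (f w').2.2, (0, 0))
  end.

Definition ext_fil p (x : ext M) : Prop :=
  [/\ tm_fil p x.1, tm_fil p x.2.1 & tm_fil p x.2.2].
(** A word has degree equal to its length. Subtraction is truncated, so values on words of length at
    least p lie in [ext_fil 0], hence are 0. *)
Definition step_fil p f : Prop := forall w, ext_fil (p - size w) (f w).

Lemma ext_two (x : ext M) : x + x = 0.
Proof. by apply: ext_eqP; apply: tm_two. Qed.

Lemma step_two f : f + f = 0.
Proof. by apply: funext => w; apply: ext_two. Qed.

Lemma step_dE f w : step_d f w =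
  (tm_d (f w).1, (tm_d (f w).2.1 + (f (true :: w)).1,
                  tm_d (f w).2.2 + (f (false :: w)).1)).
Proof.
rewrite /step_d !shufDE !shuf_constM /lstrip /shuf_map.
by apply: ext_eqP => /=; ring.
Qed.

Lemma natr_ext (b : bool) : b%:R = (b%:R, (0, 0)) :> ext M.
Proof. by case: b. Qed.

Lemma natr_shuf (b : bool) : b%:R = shuf_const b%:R :> C.
Proof. by case: b => //; apply: funext => w; rewrite shuf_const0. Qed.

Lemma step_s_nil f : step_s f [::] = (tm_s (f [::]).1, (0, 0)).
Proof. by []. Qed.

Lemma step_s_cons f v w :
  step_s f (v :: w) = (if v then (f w).2.1 else (f w).2.2, (0, 0)).
Proof. by []. Qed.

(** On the empty word [step_d] restores the two variable coefficients, and the homotopy of [M]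
    handles the constant one. On v :: w the differential of the v-coefficient at w occurs twice and
    cancels. *)
Lemma step_homotopy f : step_d (step_s f) + step_s (step_d f) =
  f + (step_eps f)%:R.
Proof.
have [dD _ _] := tm_d_gder M; have d0 := gder0 (tm_d_gder M).
apply: funext => w; rewrite natr_shuf 2!shufDE step_dE.
case: w => [|v w]; rewrite ?(step_s_nil, step_s_cons) !step_dE.
  rewrite /= natr_ext; apply: ext_eqP; rewrite /= ?d0 ?add0r ?addr0 //.
  exact: tm_homotopy.
by case: v; apply: ext_eqP; rewrite /= ?d0 ?addr0 ?add0r // addrA tm_two add0r.
Qed.

Lemma step_dd f : step_d (step_d f) = 0.
Proof.
have [dD _ _] := tm_d_gder M.
apply: funext => w; rewrite !step_dE /=.
by apply: ext_eqP; rewrite /= ?dD ?tm_dd ?add0r ?tm_two.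
Qed.

Lemma ext_gpM (y : ext M) i j : tm_eps y.1 = false ->
  ext_gp y i * ext_gp y j = ext_gp y (i + j)%N *+ 'C(i + j, i).
Proof.
have E (x : ext M) k : x *+ k = (x.1 *+ k, (x.2.1 *+ k, x.2.2 *+ k)).
  by elim: k => [|k IH]; rewrite ?mulr0n // !mulrS IH.
move=> ey; case: i => [|i]; first by rewrite bin0 mul1r.
case: j => [|j]; first by rewrite mulr1 addn0 binn.
rewrite addnS addSn E; have /= G := tm_gpM _ _ ey.
(* Both mixed terms are multiples of the same element, and Pascal's rule adds their binomial
   coefficients. *)
have H (z : M) : tm_gp y.1 i.+1 * (tm_gp y.1 j * z) + tm_gp y.1 i * z * tm_gp y.1 j.+1
  = tm_gp y.1 (i + j).+1 * z *+ 'C((i + j).+2, i.+1).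
  rewrite mulrA G mulrAC G !mulrnAl addSn addnS -mulrnDr binS; congr (_ *+ _).
by apply: ext_eqP; rewrite /= ?H // G addSn addnS.
Qed.

Lemma lstrip_gp v f i : lstrip v (step_gp f i.+1) = lstrip v f * step_gp f i.
Proof. by []. Qed.

Lemma shufMn f k w : (f *+ k) w = f w *+ k.
Proof. by elim: k => [|k IH]; rewrite ?mulr0n // !mulrS shufDE IH. Qed.

Lemma step_gpM f i j : step_eps f = false ->
  step_gp f i * step_gp f j = step_gp f (i + j)%N *+ 'C(i + j, i).
Proof.
move=> ef; elim: i j => [|i IHi] j; first by rewrite bin0 mul1r.
elim: j => [|j IHj]; first by rewrite mulr1 addn0 binn.
apply: funext => -[|v w]; rewrite shufMn.
  exact: (@ext_gpM _ i.+1 j.+1 ef).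
rewrite shufM_cons !lstrip_gp -mulrA IHi mulrCA IHj.
by rewrite -shufDE !addSn !addnS !mulrnAr -mulrnDr shufMn
  [X in _ *+ X = _]addnC -binS.
Qed.

Local Notation mgder := (gamma_derivation (@tm_eps M) (@tm_gp M)).
Local Notation cgder := (gamma_derivation step_eps step_gp).

Lemma gder_ext_map t : mgder t ->
  gamma_derivation (fun x : ext M => tm_eps x.1) ext_gp (ext_map t).
Proof.
move=> dt; have [tD tM tG] := dt; split=> [x y|x y|y i ey].
- by apply: ext_eqP => /=; rewrite tD.
- by apply: ext_eqP => /=; rewrite ?tD !tM //; ring.
- case: i => [|i].
    by rewrite mulr1; apply: ext_eqP; rewrite /= ?tG ?tm_gp0 ?mulr1 ?mul1r.
  by apply: ext_eqP; rewrite /= ?tM !tG //; ring.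
Qed.

(* All Gamma-derivations of a shuffle algebra considered here commute with the
   left strips; the divided power rule then propagates from the empty word. *)
Lemma gder_shuf (t : C -> C) :
  (forall f g, t (f + g) = t f + t g) ->
  (forall f g, t (f * g) = t f * g + f * t g) ->
  (forall v f, lstrip v (t f) = t (lstrip v f)) ->
  (forall f i, step_eps f = false ->
     t (step_gp f i.+1) [::] = (t f * step_gp f i) [::]) ->
  cgder t.
Proof.
move=> tD tM tl t0; split=> // f i ef.
have t1 : t 1 = 0.
  by apply: (addrI (t 1)); rewrite addr0 -[in RHS](mulr1 1) tM mulr1 mul1r.
elim: i => [|i IH]; apply: funext => -[|v w]; try exact: t0.
  rewrite -[LHS]/(lstrip v (t (step_gp f 1)) w) tl lstrip_gp /=.
  by rewrite !mulr1 -tl.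
rewrite -[LHS]/(lstrip v (t (step_gp f i.+2)) w) tl lstrip_gp tM IH.
by rewrite shufDE mulrCA shufM_cons lstrip_gp tl.
Qed.

Lemma gder_shuf_map t : mgder t -> cgder (shuf_map (ext_map t)).
Proof.
move=> dt; have [eD eM eG] := gder_ext_map dt; apply: gder_shuf => //.
- by move=> f g; apply: funext => w; apply: eD.
- exact: shuf_mapM.
- move=> f i ef; rewrite /shuf_map /= eG // shufME /=; congr (_ * _).
  by case: i.
Qed.

Lemma gder_lstrip v : cgder (lstrip v).
Proof. by split. Qed.

Lemma gder_rstrip v : cgder (rstrip v).
Proof.
by apply: gder_shuf => // f g; apply: rstripM.
Qed.

Lemma gder_step_d : cgder step_d.
Proof.
apply: gder_add; last by apply: gder_mull; apply: gder_lstrip.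
apply: gder_add; last by apply: gder_mull; apply: gder_lstrip.
exact: gder_shuf_map (tm_d_gder M).
Qed.

End Step.

Lemma tm_fil_le (M : tate_model) p q (x : M) :
  (p <= q)%N -> tm_fil p x -> tm_fil q x.
Proof.
move=> /subnK <-; elim: (q - p)%N => [//|k IH] fx.
by apply: tm_filS; apply: IH.
Qed.

Lemma tm_eps0 (M : tate_model) : tm_eps (0 : M) = false.
Proof. by rewrite -(tm_two (0 : M)) tm_epsD addbb. Qed.

Section Step.
Variable M : tate_model.
Local Notation C := (shuf (ext M)).
Implicit Types (f g h : C) (v : bool) (w : seq bool).

Lemma ext_fil0 p : @ext_fil M p 0.
Proof. by split; apply: tm_fil0. Qed.

Lemma ext_fil_eq0 (x : ext M) : ext_fil 0 x -> x = 0.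
Proof. by case=> a b c; apply: ext_eqP; apply: tm_fil_eq0. Qed.

Lemma ext_filD p (x y : ext M) : ext_fil p x -> ext_fil p y -> ext_fil p (x + y).
Proof. by move=> [a b c] [a' b' c']; split; apply: tm_filD. Qed.

Lemma ext_filM p q (x y : ext M) : ext_fil p.+1 x -> ext_fil q.+1 y ->
  ext_fil (p + q).+1 (x * y).
Proof.
move=> [a b c] [a' b' c']; split; first exact: tm_filM.
- by apply: tm_filD; apply: tm_filM.
- by apply: tm_filD; apply: tm_filM.
Qed.

Lemma step_fil_eq0 f : step_fil 0 f -> f = 0.
Proof. by move=> ff; apply: funext => w; apply: ext_fil_eq0; apply: ff. Qed.

Lemma step_fil0 p : step_fil p (0 : C).
Proof. by move=> w; apply: ext_fil0. Qed.

Lemma step_fil_const p c : ext_fil p c -> step_fil p (shuf_const c : C).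
Proof. by move=> fc [|v w]; rewrite ?subn0 //=; apply: ext_fil0. Qed.

Lemma step_fil1 : step_fil 1 (1 : C).
Proof.
apply: step_fil_const; split; try exact: tm_fil0.
exact: tm_fil1.
Qed.

Lemma step_filS p f : step_fil p f -> step_fil p.+1 f.
Proof.
by move=> ff w; case: (ff w) => a b c; split; apply: (tm_fil_le (p := p - size w));
  rewrite // leq_sub2r.
Qed.

Lemma step_filD p f g : step_fil p f -> step_fil p g -> step_fil p (f + g).
Proof. by move=> ff fg w; apply: ext_filD. Qed.

Lemma step_fil_lstrip p v f : step_fil p.+1 f -> step_fil p (lstrip v f).
Proof. by move=> ff w; apply: (ff (v :: w)). Qed.

Lemma step_fil_rstrip p v f : step_fil p.+1 f -> step_fil p (rstrip v f).
Proof. by move=> ff w; have := ff (rcons w v); rewrite size_rcons. Qed.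

Lemma step_filM p q f g : step_fil p.+1 f -> step_fil q.+1 g ->
  step_fil (p + q).+1 (f * g).
Proof.
move=> ff fg w; elim: w p q f g ff fg => [|v w IH] p q f g ff fg.
  exact: ext_filM (ff [::]) (fg [::]).
rewrite shufM_cons subSS; apply: ext_filD.
  have := step_fil_lstrip v ff; case: p {ff} => [/step_fil_eq0->|p ff].
    by rewrite mul0r; apply: ext_fil0.
  exact: IH.
have := step_fil_lstrip v fg; case: q {fg} => [/step_fil_eq0->|q fg].
  by rewrite mulr0; apply: ext_fil0.
by rewrite addnS; apply: IH.
Qed.

Lemma tm_fil_map (t : M -> M) r p x : t 0 = 0 ->
  (forall q y, tm_fil (q + r) y -> tm_fil q (t y)) ->
  tm_fil p x -> tm_fil (p - r) (t x).
Proof.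
move=> t0 ft; case: (leqP r p) => [rp fx|pr fx].
  by apply: ft; rewrite subnK.
rewrite (_ : p - r = 0)%N; last by lia.
by apply: ft; apply: tm_fil_le fx; lia.
Qed.

Lemma step_fil_map (t : M -> M) r p f : t 0 = 0 ->
  (forall q y, tm_fil (q + r) y -> tm_fil q (t y)) ->
  step_fil (p + r) f -> step_fil p (shuf_map (ext_map t) f : C).
Proof.
move=> t0 ft ff w; have [a b c] := ff w.
have -> : (p - size w = (p + r - size w) - r)%N by lia.
by split; apply: tm_fil_map.
Qed.

Lemma step_fil_d p f : step_fil p.+1 f -> step_fil p (step_d f).
Proof.
move=> ff w; have d0 := gder0 (tm_d_gder M).
have fd q (y : M) : tm_fil (q + 1) y -> tm_fil q (tm_d y).
  by rewrite addn1; apply: tm_fil_d.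
have [a b c] : ext_fil (p - size w) (shuf_map (ext_map (@tm_d M)) f w).
  by apply: (step_fil_map d0 fd); rewrite addn1.
rewrite step_dE; split=> //; apply: tm_filD => //.
  by have [] := step_fil_lstrip true ff w.
by have [] := step_fil_lstrip false ff w.
Qed.

Lemma step_fil_s p f : step_fil p f -> step_fil p.+1 (step_s f).
Proof.
move=> ff [|v w].
  have [a _ _] := ff [::]; rewrite step_s_nil; split=> /=; try exact: tm_fil0.
  by apply: tm_fil_s; rewrite subn0 in a.
have [_ a b] := ff w; rewrite step_s_cons subSS.
by split; try exact: tm_fil0; case: v.
Qed.

Lemma step_eps_gp f i : step_eps f = false -> step_eps (step_gp f i.+1) = false.
Proof. exact: tm_eps_gp. Qed.

Lemma ext_fil_gp p (y : ext M) i : tm_eps y.1 = false -> ext_fil p.+1 y ->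
  ext_fil (i * p).+1 (ext_gp y i).
Proof.
move=> ey [a b c]; case: i => [|i].
  by split; [exact: tm_fil1|exact: tm_fil0|exact: tm_fil0].
split; first exact: tm_fil_gp.
- by rewrite /= mulSn addnC; apply: tm_filM => //; apply: tm_fil_gp.
- by rewrite /= mulSn addnC; apply: tm_filM => //; apply: tm_fil_gp.
Qed.

Lemma step_fil_gp p f i : step_eps f = false -> step_fil p.+1 f ->
  step_fil (i * p).+1 (step_gp f i).
Proof.
move=> ef ff; elim: i => [|i IH]; first exact: step_fil1.
move=> [|v w]; first by apply: ext_fil_gp => //; apply: (ff [::]).
rewrite -[step_gp f i.+1 (v :: w)]/((lstrip v f * step_gp f i) w) subSS.
case: p ff IH => [|p] ff IH.
  rewrite (step_fil_eq0 (step_fil_lstrip v ff)) mul0r; exact: ext_fil0.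
rewrite mulSn addSn.
exact: (step_filM (step_fil_lstrip v ff) IH w).
Qed.

Lemma step_epsD f g : step_eps (f + g) = step_eps f (+) step_eps g.
Proof. exact: tm_epsD. Qed.

Lemma step_epsM f g : step_eps (f * g) = step_eps f && step_eps g.
Proof. exact: tm_epsM. Qed.

Lemma step_gp1 f : step_eps f = false -> step_gp f 1 = f.
Proof.
move=> ef; apply: funext => -[|v w]; last by rewrite /= mulr1.
by apply: ext_eqP; rewrite /= ?tm_gp1 ?tm_gp0 ?mul1r.
Qed.

Lemma step_eps_d f : step_eps (step_d f) = false.
Proof. by rewrite /step_eps step_dE tm_eps_d. Qed.

Lemma step_eps_s f : step_eps (step_s f) = false.
Proof. exact: tm_eps_s. Qed.

Definition step_model : tate_model :=
  @TateModel C (@step_d M) (@step_s M) (@step_eps M) (@step_fil M) (@step_gp M)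
    (@step_two M) step_epsD step_epsM (tm_eps1 M) step_fil_eq0 step_fil0
    step_fil1 step_filS step_filD step_filM (fun _ _ => erefl) step_gp1
    (fun y i j => @step_gpM M y i j) step_eps_gp step_fil_gp (@gder_step_d M)
    (@step_dd M) step_eps_d step_fil_d step_eps_s step_fil_s (@step_homotopy M).

(** * Chain derivations and words *)

Local Notation gder M := (gamma_derivation (@tm_eps M) (@tm_gp M)).

(** The last clause says that degree drops by at least r. In particular elements of degree below r
    are killed, since [tm_fil 0] is zero. *)
Definition chain_derivation (N : tate_model) (r : nat) (t : N -> N) : Prop :=
  [/\ gder N t, forall x, t (tm_d x) = tm_d (t x) &
      forall p x, tm_fil (p + r) x -> tm_fil p (t x)].

Lemma chain_derivation_commutator (N : tate_model) r q (t u : N -> N) :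
  chain_derivation r t -> chain_derivation q u ->
  chain_derivation (r + q) (fun x => t (u x) + u (t x)).
Proof.
move=> [dt td ft] [du ud fu]; have [dD _ _] := tm_d_gder N; split.
- exact: gder_commutator (@tm_two N) (@tm_gp0 N) dt du.
- by move=> x; rewrite ud td td ud dD.
- move=> p x fx; apply: tm_filD.
    by apply: ft; apply: fu; rewrite -addnA.
  by apply: fu; apply: ft; rewrite -addnA [(q + r)%N]addnC.
Qed.

(** The differential touches only coefficients and the left end of a word, so it commutes with
    stripping from the right. *)
Lemma chain_derivation_rstrip v :
  chain_derivation 1 (rstrip v : step_model -> step_model).
Proof.
split; first exact: gder_rstrip.
- by move=> f; apply: funext => w; rewrite /= /rstrip !step_dE.
- by move=> p f; rewrite addn1; apply: step_fil_rstrip.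
Qed.

(** This carries derivations of the inner resolution to the outer one, acting on coefficients. *)
Lemma chain_derivation_map r (t : M -> M) : chain_derivation r t ->
  chain_derivation r (shuf_map (ext_map t) : step_model -> step_model).
Proof.
move=> [dt td ft]; have [tD _ _] := dt; split; first exact: gder_shuf_map.
- move=> f; apply: funext => w; rewrite /shuf_map /= !step_dE.
  by apply: ext_eqP; rewrite /= ?tD ?td.
- by move=> p f; apply: step_fil_map => //; apply: gder0 dt.
Qed.

(** The iterated commutator (ad x_1)^n x_2 with x_1 = [rstrip true] and x_2 = [rstrip false]; in
    characteristic 2 the bracket is a sum. *)
Definition ad_rstrip n : step_model -> step_model :=
  iter n (fun (t : step_model -> step_model) f =>
            t (rstrip true f) + rstrip true (t f)) (rstrip false).

Lemma ad_rstripS n f :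
  ad_rstrip n.+1 f = ad_rstrip n (rstrip true f) + rstrip true (ad_rstrip n f).
Proof. by []. Qed.

Lemma chain_derivation_ad_rstrip n : chain_derivation n.+1 (ad_rstrip n).
Proof.
elim: n => [|n IH]; first exact: chain_derivation_rstrip.
rewrite -addn1; apply: chain_derivation_commutator => //.
exact: chain_derivation_rstrip.
Qed.

Lemma ad_rstrip0 n : ad_rstrip n 0 = 0.
Proof. by have [/gder0] := chain_derivation_ad_rstrip n. Qed.

Definition word (a : seq bool) : step_model := fun w => (w == a)%:R.

Lemma lstrip_word v u a : lstrip v (word (u :: a)) = if v == u then word a else 0.
Proof.
by apply: funext => w; rewrite /lstrip /word eqseq_cons; case: (v == u).
Qed.

Lemma rstrip_word v u a : rstrip v (word (rcons a u)) = if v == u then word a else 0.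
Proof.
apply: funext => w; rewrite /rstrip /word eqseq_rcons andbC.
by case: (v == u).
Qed.

Lemma word_nil : word [::] = 1.
Proof. by apply: funext => -[]. Qed.

(** The only letter [false] stands at the right end, so only the summand that strips it first
    survives; that summand then strips n letters [true]. *)
Lemma ad_rstrip_word n k :
  ad_rstrip n (word (rcons (nseq (n + k) true) false)) = word (nseq k true).
Proof.
elim: n k => [|n IH] k; first exact: rstrip_word.
rewrite ad_rstripS rstrip_word ad_rstrip0 add0r addSnnS IH.
by rewrite -addn1 nseqD cats1 rstrip_word.
Qed.

(** The coefficients of a word are 0 and 1, which derivations kill. Hence derivations coming from Z
    vanish on words in X. *)
Lemma shuf_map_word (t : M -> M) a : gder M t ->
  shuf_map (ext_map t) (word a) = 0.
Proof.
move=> dt; apply: funext => w; rewrite /shuf_map /word.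
by case: (w == a); apply: ext_eqP; rewrite /= ?(gder0 dt) ?(gder1 dt).
Qed.

Lemma step_d_word v a : tm_d (word (v :: a)) = step_var M v * word a.
Proof.
rewrite /= /step_d shuf_map_word; last exact: tm_d_gder.
by rewrite !lstrip_word; case: v; rewrite ?mulr0 ?addr0 add0r.
Qed.

Lemma step_fil_word a : tm_fil (size a).+1 (word a).
Proof.
move=> w; rewrite /word; case: eqP => [->|_]; last exact: ext_fil0.
by rewrite subSnn; split; [exact: tm_fil1|exact: tm_fil0|exact: tm_fil0].
Qed.

Lemma step_eps_word a : tm_eps (word a) = (a == [::]).
Proof.
rewrite /= /step_eps /word eq_sym.
by case: eqP => _; [exact: tm_eps1|exact: tm_eps0].
Qed.

Lemma step_varM v u : step_var M v * step_var M u = 0.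
Proof.
apply: funext => w; rewrite shuf_constM.
case: w => [|s w]; last by rewrite /= mulr0.
by apply: ext_eqP; rewrite /= ?mul0r ?mulr0 ?addr0.
Qed.

Lemma step_eps_var v : step_eps (step_var M v) = false.
Proof. exact: tm_eps0. Qed.

Lemma step_fil_var v : step_fil 1 (step_var M v).
Proof.
apply: step_fil_const; split; first exact: tm_fil0.
  by case: v; [exact: tm_fil1|exact: tm_fil0].
by case: v; [exact: tm_fil0|exact: tm_fil1].
Qed.

Definition step_lift (b : M) : step_model := shuf_const (b, (0, 0)).

Lemma step_liftM a b : step_lift (a * b) = step_lift a * step_lift b.
Proof.
apply: funext => w; rewrite shuf_constM; case: w => [|v w] /=; last by rewrite mulr0.
by apply: ext_eqP; rewrite /= ?mulr0 ?mul0r ?addr0.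
Qed.

Lemma step_lift1 : step_lift 1 = 1. Proof. by []. Qed.

Lemma step_lift0 : step_lift 0 = 0.
Proof. by apply: funext => -[]. Qed.

Lemma step_eps_lift b : tm_eps (step_lift b) = tm_eps b. Proof. by []. Qed.

Lemma step_fil_lift p b : tm_fil p b -> tm_fil p (step_lift b).
Proof. by move=> fb; apply: step_fil_const; split=> //; apply: tm_fil0. Qed.

Lemma shuf_map_lift (t : M -> M) b : t 0 = 0 ->
  shuf_map (ext_map t) (step_lift b) = step_lift (t b).
Proof.
move=> t0; apply: funext => -[|v w]; rewrite /shuf_map /ext_map /= t0 //.
Qed.

Lemma step_d_lift b : tm_d (step_lift b) = step_lift (tm_d b).
Proof.
rewrite /= /step_d shuf_map_lift; last exact: gder0 (tm_d_gder M).
have E v : lstrip v (step_lift b) = 0 by [].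
by rewrite (E true) (E false) !mulr0 !addr0.
Qed.

(** Right strips act on words and [t] on coefficients. This is why the derivations from X and from Z
    commute. *)
Lemma ad_rstrip_map n (t : M -> M) f : (forall x y, t (x + y) = t x + t y) ->
  ad_rstrip n (shuf_map (ext_map t) f) = shuf_map (ext_map t) (ad_rstrip n f).
Proof.
move=> tD; elim: n f => [|n IH] f; first exact: erefl.
rewrite !ad_rstripS.
rewrite (_ : rstrip true (shuf_map _ f) = shuf_map (ext_map t) (rstrip true f)) //.
rewrite !IH; apply: funext => w; rewrite shufDE /shuf_map shufDE.
by apply: ext_eqP; rewrite /= tD.
Qed.

End Step.

(** * The comparison map from a partial acyclic closure *)

Section CharTwo.
Variables (S : comNzRingType) (A : dgGammaAlgebra S).
Hypothesis S_two : forall r : S, r + r = 0.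
Implicit Types (x y : A).

Lemma dg_two x : x + x = 0.
Proof. by rewrite -[x]scale1r -scalerDl S_two scale0r. Qed.

Lemma dg_opp x : - x = x.
Proof. by apply: (addrI x); rewrite subrr dg_two. Qed.

Lemma dg_sign k : (-1) ^+ k = 1 :> A.
Proof. by rewrite dg_opp expr1n. Qed.

Lemma dg_mul_comm x y : x * y = y * x.
Proof.
have [p [b [hb ->]]] := dg_hom_span x; have [q [c [hc ->]]] := dg_hom_span y.
rewrite mulr_suml mulr_sumr; apply: eq_bigr => i _.
rewrite mulr_suml mulr_sumr; apply: eq_bigr => j _.
by rewrite (dg_mulC (hb i) (hc j)) dg_sign mul1r.
Qed.

Lemma dg_leibniz2 x y : dg_d (x * y) = dg_d x * y + x * dg_d y.
Proof.
have [p [b [hb ->]]] := dg_hom_span x.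
rewrite mulr_suml !linear_sum /= !mulr_suml -big_split /=; apply: eq_bigr => i _.
by rewrite (dg_leibniz _ (hb i)) dg_sign mul1r.
Qed.

Lemma dg_d1 : dg_d (1 : A) = 0.
Proof. exact: dg_d_hom0 (dg_hom1 A). Qed.

(** In characteristic 2 graded commutativity is plain commutativity, so monomials of [A] can be
    handled as products in a commutative ring. *)
Definition dg_nz : nzRingType := A.
Definition dg_com : comNzRingType := HB.pack_for comNzRingType dg_nz
  (GRing.PzRing_hasCommutativeMul.Build dg_nz dg_mul_comm).

Lemma dg_homX i x k : dg_hom i x -> dg_hom (k * i) (x ^+ k).
Proof.
move=> hx; elim: k => [|k IH]; first exact: dg_hom1.
by rewrite exprS mulSn; apply: dg_homM.
Qed.

Lemma dg_hom_sum i (I : Type) (s : seq I) (P : pred I) (F : I -> A) :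
  (forall j, P j -> dg_hom i (F j)) -> dg_hom i (\sum_(j <- s | P j) F j).
Proof.
by move=> hF; apply: (big_ind (dg_hom i)) => //; [exact: dg_hom0|exact: dg_homD].
Qed.

End CharTwo.

(** * Monomials in Gamma-variables *)

Section GammaSystem.
Variables (N : nat) (deg : 'I_N -> nat).
Local Notation expo := {ffun 'I_N -> nat}.

(** The multiplication rules shared by the variables of [A] and their images in the model: powers of
    square-zero elements in odd degree, divided powers in even degree. Monomials on both sides
    therefore multiply alike. *)
Definition gamma_system (R : comNzRingType) (f : 'I_N -> nat -> R) : Prop :=
  [/\ forall i, f i 0%N = 1,
      forall i j k, f i j * f i k
        = f i (j + k)%N *+ (if odd (deg i) then 1%N else 'C(j + k, j)) &
      forall i, odd (deg i) -> f i 1%N * f i 1%N = 0].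

Definition expo_add (a b : expo) : expo := [ffun i => (a i + b i)%N].

Definition gamma_binom (a b : expo) : nat :=
  \prod_i (if odd (deg i) then 1%N else 'C(a i + b i, a i)).

Lemma gamma_system_mul (R : comNzRingType) f (a b : expo) :
  @gamma_system R f ->
  (\prod_i f i (a i)) * (\prod_i f i (b i))
  = (\prod_i f i (expo_add a b i)) *+ gamma_binom a b.
Proof.
case=> _ fM _; rewrite -big_split /= -prodrMn /=; apply: eq_bigr => i _.
by rewrite fM ffunE.
Qed.

Lemma gamma_system_eq0 (R : comNzRingType) f (a b : expo) i :
  @gamma_system R f -> odd (deg i) -> a i = 1%N -> b i = 1%N ->
  (\prod_i f i (a i)) * (\prod_i f i (b i)) = 0.
Proof.
case=> _ _ f0 oi ai bi; rewrite -big_split /= (bigD1 i) //=.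
by rewrite ai bi f0 // mul0r.
Qed.

End GammaSystem.

(** Collects terms with equal labels, because linear independence in [is_basis_mod] is stated for
    duplicate-free sequences. *)
Lemma sum_regroup (S : nmodType) (L : eqType) (V : nmodType) (g : L -> S -> V)
    (t : seq (S * L)) :
  (forall l, g l 0 = 0) -> (forall l r s, g l (r + s) = g l r + g l s) ->
  \sum_(p <- t) g p.2 p.1
  = \sum_(l <- undup (map snd t)) g l (\sum_(p <- t | p.2 == l) p.1).
Proof.
move=> g0 gD.
have gS l (u : seq (S * L)) : g l (\sum_(p <- u | p.2 == l) p.1)
    = \sum_(p <- u | p.2 == l) g p.2 p.1.
  elim: u => [|p u IH]; first by rewrite !big_nil g0.
  by rewrite !big_cons; case: eqP => // e; rewrite gD IH e.
under [RHS]eq_bigr => l _ do rewrite gS.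
rewrite (exchange_big_dep xpredT) //=.
rewrite big_seq [RHS]big_seq; apply: eq_bigr => p pt.
rewrite (eq_bigl (pred1 p.2)) => [|l]; last by rewrite /= eq_sym.
rewrite -big_filter filter_pred1_uniq ?undup_uniq ?big_seq1 //.
by rewrite mem_undup map_f.
Qed.

Section Comparison.
Variables (S : comNzRingType) (m : set S) (A : dgGammaAlgebra S).
Variables (N : nat) (deg : 'I_N -> nat) (X : 'I_N -> A) (n : nat).
Hypothesis S_two : forall r : S, r + r = 0.
Hypothesis hPAC : is_partial_acyclic_closure m deg X n.
Local Notation expo := {ffun 'I_N -> nat}.

Let deg_gt0 i : (0 < deg i)%N.
Proof. by case: hPAC => /(_ i) [/andP[]]. Qed.
Let X_hom i : dg_hom (deg i) (X i).
Proof. by case: hPAC => /(_ i) []. Qed.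

Definition gamma_factor i k : A :=
  if odd (deg i) then X i ^+ k else dg_dpow k (X i).

Local Notation M := (gamma_monomial deg X).

Lemma gamma_factor_hom i k : dg_hom (k * deg i) (gamma_factor i k).
Proof.
rewrite /gamma_factor; case: ifP => o; first exact: dg_homX.
by apply: dg_dpow_hom; rewrite ?o.
Qed.

Lemma gamma_factor_system :
  gamma_system deg (gamma_factor : 'I_N -> nat -> dg_com A S_two).
Proof.
split=> [i|i j k|i o]; rewrite /gamma_factor.
- case: ifP => o; first exact: expr0.
  by rewrite (dg_dpow0 (k := deg i)) ?o.
- case: ifP => o; first by rewrite -[RHS]/(X i ^+ (j + k)) exprD.
  by apply: (@dg_dpow_mul _ A (deg i)); rewrite ?o.
- by rewrite o; apply: (@dg_sqr_odd _ A (deg i)) => //; rewrite expr1.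
Qed.

Definition weight (a : expo) : nat := \sum_i a i * deg i.

Lemma gamma_monomialE a : M a = \prod_(i < N) (gamma_factor i (a i) : dg_com A S_two).
Proof. by []. Qed.

Lemma gamma_monomial_hom a : dg_hom (weight a) (M a).
Proof.
rewrite /weight /gamma_monomial; elim/big_rec2: _ => [|i x k _ IH]; first exact: dg_hom1.
by apply: dg_homM => //; apply: gamma_factor_hom.
Qed.

Definition terms := seq (S * expo).
Definition eval_terms (t : terms) : A := \sum_(p <- t) p.1 *: M p.2.
Definition wf_terms q (t : terms) : bool := all (fun p => gamma_exponent deg q p.2) t.

Lemma eval_terms_cat t u : eval_terms (t ++ u) = eval_terms t + eval_terms u.
Proof. exact: big_cat. Qed.

Lemma wf_terms_cat q t u : wf_terms q (t ++ u) = wf_terms q t && wf_terms q u.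
Proof. exact: all_cat. Qed.

Lemma gamma_sub_terms q (z : A) :
  gamma_sub deg X q z <-> exists2 t, wf_terms q t & z = eval_terms t.
Proof.
split=> [[s [r [ws ->]]]|[t wt ->]].
  exists [seq (r a, a) | a <- s]; last by rewrite /eval_terms big_map.
  by rewrite /wf_terms all_map; apply: sub_all ws.
exists (undup (map snd t)), (fun l => \sum_(p <- t | p.2 == l) p.1); split.
  apply/allP => a; rewrite mem_undup => /mapP[p pt ->].
  by move/allP: wt => /(_ _ pt).
rewrite /eval_terms (sum_regroup (g := fun l r => r *: M l)) // => [l|l r s].
  exact: scale0r.
exact: scalerDl.
Qed.

Lemma eval_terms_surj z : exists2 t, wf_terms n t & z = eval_terms t.
Proof.
apply/gamma_sub_terms; case: hPAC => _ [_ /(_ z I) [s [r [ws hz]]] _] _ _.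
by exists s, r; split=> //; apply/eqP; rewrite -subr_eq0; apply/eqP.
Qed.

(** As the grading is direct, the terms of weight other than q cancel and may be dropped. *)
Lemma hom_terms q (z : A) : dg_hom q z ->
  exists t, [/\ wf_terms n t, z = eval_terms t &
                forall p, p \in t -> weight p.2 = q].
Proof.
move=> hz; have [t wt zt] := eval_terms_surj z.
exists [seq p <- t | weight p.2 == q]; split.
- by apply/allP => p; rewrite mem_filter => /andP[_]; move/allP: wt; apply.
- pose P := (\max_(p <- t) weight p.2 + q).+1.
  have wP p : p \in t -> (weight p.2 < P)%N.
    move=> pt; rewrite /P ltnS; apply: leq_trans (leq_addr _ _).
    exact: (leq_bigmax_seq (F := fun p : S * expo => weight p.2) p pt).
  pose c k := \sum_(p <- t | weight p.2 == k) p.1 *: M p.2.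
  have c_hom k : dg_hom k (c k).
    apply: dg_hom_sum => p /eqP <-; apply: dg_homZ; exact: gamma_monomial_hom.
  have qP : (q < P)%N by rewrite /P ltnS leq_addl.
  have cz : \sum_(k < P) c k = z.
    rewrite zt /eval_terms /c (exchange_big_dep xpredT) //=.
    rewrite big_seq [RHS]big_seq; apply: eq_bigr => p pt.
    by rewrite (eq_bigl (pred1 (Ordinal (wP p pt)))) ?big_pred1_eq.
  have e0 : c q - z = 0.
    have := @dg_hom_direct _ A P (fun k => c k - (if k == q then z else 0)).
    move=> /(_ _ _ q qP); rewrite eqxx; apply.
      move=> k; rewrite dg_opp //; apply: dg_homD => //.
      by case: eqP => [->|_] //; apply: dg_hom0.
    rewrite sumrB cz -(big_mkord xpredT (fun k => if k == q then z else 0)).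
    by rewrite -big_mkcond big_mkord (big_pred1 (Ordinal qP)) ?subrr.
  rewrite /eval_terms big_filter; apply/esym/eqP; rewrite -subr_eq0; exact/eqP.
- by move=> p; rewrite mem_filter => /andP[/eqP].
Qed.

Lemma weight_exponent q a : gamma_exponent deg n a -> (weight a <= q)%N ->
  gamma_exponent deg q a.
Proof.
move=> /forallP ga wa; apply/forallP => i; have /andP[-> _] := ga i.
apply/implyP => qi; rewrite -leqn0 leqNgt; apply/negP => ai.
have : (a i * deg i <= weight a)%N by rewrite /weight (bigD1 i) //= leq_addr.
have : (1 * deg i <= a i * deg i)%N by rewrite leq_mul2r ai orbT.
lia.
Qed.

Lemma hom_gamma_sub q (z : A) : dg_hom q z -> gamma_sub deg X q z.
Proof.
move=> /hom_terms[t [wt -> wq]]; apply/gamma_sub_terms; exists t => //.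
apply/allP => p pt; apply: weight_exponent; last by rewrite wq.
by move/allP: wt; apply.
Qed.

(** Elements of degree q involve only variables of degree at most q, so [z] is a cycle of the
    subalgebra whose q-th homology the variables of degree q + 1 kill. *)
Lemma exact_degree q (z : A) : (0 < q < n)%N -> dg_hom q z -> dg_d z = 0 ->
  exists2 b, dg_hom q.+1 b & dg_d b = z.
Proof.
move=> hq hz dz; case: hPAC => _ _ _ /(_ q hq) [[_ /(_ z)] ].
case=> [|r [b [_ hb e]] _]; first by split=> //; apply: hom_gamma_sub.
exists (b + \sum_(i | deg i == q.+1) r i *: X i).
  apply: dg_homD => //; apply: dg_hom_sum => i /eqP <-; exact: dg_homZ.
rewrite linearD linear_sum /= -e addrC.
rewrite (eq_bigr (fun i => r i *: dg_d (X i))) => [|i _]; last by rewrite linearZ.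
by rewrite addrC subrK.
Qed.

Lemma exact_degree0 s : m s -> exists2 b : A, dg_hom 1 b & dg_d b = s%:A.
Proof.
move=> ms; case: hPAC => _ _ [f [fX [[_ /(_ s ms) [r e]] _]]] _.
exists (\sum_(i | deg i == 1%N) r i *: X i).
  by apply: dg_hom_sum => i /eqP <-; apply: dg_homZ.
have -> : s = \sum_(i | deg i == 1%N) r i * f i.
  by apply/eqP; rewrite -subr_eq0; apply/eqP.
rewrite linear_sum scaler_suml; apply: eq_bigr => i /eqP di.
by rewrite linearZ /= fX // scalerA.
Qed.

End Comparison.

Lemma tm_fil_prod (M : tate_model) (I : Type) (s : seq I) (F : I -> M) (w : I -> nat) :
  (forall i, tm_fil (w i).+1 (F i)) ->
  tm_fil (\sum_(i <- s) w i).+1 (\prod_(i <- s) F i).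
Proof.
move=> fF; elim/big_rec2: _ => [|i x k _ IH]; first exact: tm_fil1.
exact: tm_filM.
Qed.

Lemma tm_fil_sum (M : tate_model) p (I : eqType) (s : seq I) (F : I -> M) :
  (forall i, i \in s -> tm_fil p (F i)) -> tm_fil p (\sum_(i <- s) F i).
Proof.
move=> fF; rewrite big_seq; apply: (big_ind (tm_fil p)) => //.
- exact: tm_fil0.
- exact: tm_filD.
Qed.

Lemma tm_eps_sum (M : tate_model) (I : eqType) (s : seq I) (F : I -> M) :
  (forall i, i \in s -> tm_eps (F i) = false) ->
  tm_eps (\sum_(i <- s) F i) = false.
Proof.
move=> fF; rewrite big_seq; apply: (big_ind (fun x => tm_eps x = false)) => //.
- exact: tm_eps0.
- by move=> x y hx hy; rewrite tm_epsD hx hy.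
Qed.

(** The contraction is not assumed additive. The homotopy at 0 reads d s 0 + s 0 = 0, and applying d
    gives d s 0 = 0. *)
Lemma tm_s0 (M : tate_model) : tm_s (0 : M) = 0.
Proof.
have [dD _ _] := tm_d_gder M; have d0 := gder0 (tm_d_gder M).
have := tm_homotopy (0 : M); rewrite d0 tm_eps0 addr0 => h.
have ds0 : tm_d (tm_s (0 : M)) = 0.
  by have := congr1 (@tm_d M) h; rewrite dD tm_dd add0r d0.
by move: h; rewrite ds0 add0r.
Qed.

(** * Construction of the comparison map *)

Section Comparison.
Variables (S : comNzRingType) (m : set S) (A : dgGammaAlgebra S).
Variables (N : nat) (deg : 'I_N -> nat) (X : 'I_N -> A) (n : nat).
Hypothesis S_two : forall r : S, r + r = 0.
Hypothesis hPAC : is_partial_acyclic_closure m deg X n.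
Variables (D : tate_model) (iota : S -> D).
Hypothesis iotaD : forall r s, iota (r + s) = iota r + iota s.
Hypothesis iotaM : forall r s, iota (r * s) = iota r * iota s.
Hypothesis iota1 : iota 1 = 1.
Hypothesis iota_fil : forall r, tm_fil 1 (iota r).
Hypothesis iota_eps : forall r, m r -> tm_eps (iota r) = false.
Local Notation expo := {ffun 'I_N -> nat}.
Local Notation terms := (terms S N).
Local Notation M := (gamma_monomial deg X).
Local Notation ev := (eval_terms deg X).
Local Notation wf := (@wf_terms S N deg).

Let iota0 : iota 0 = 0.
Proof. by apply: (addrI (iota 0)); rewrite -iotaD !addr0. Qed.

Section Phi.
Variable y : 'I_N -> D.
Hypothesis y_eps : forall i, tm_eps (y i) = false.

Definition model_factor i k : D := if odd (deg i) then y i ^+ k else tm_gp (y i) k.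
Definition model_monomial (a : expo) : D := \prod_i model_factor i (a i).
Definition eval_model (t : terms) : D :=
  \sum_(p <- t) iota p.1 * model_monomial p.2.

Lemma model_factor_system : gamma_system deg model_factor.
Proof.
split=> [i|i j k|i o]; rewrite /model_factor.
- by case: ifP => o; rewrite ?expr0 ?tm_gp0.
- by case: ifP => o; rewrite ?exprD // tm_gpM.
- by rewrite o expr1 -(tm_gp1 (y_eps i)) tm_gpM // mulr2n tm_two.
Qed.

(** Well-definedness of the comparison map: freeness of [A] on the monomials makes every collected
    coefficient 0. *)
Lemma eval_model_eq0 t : wf n t -> ev t = 0 -> eval_model t = 0.
Proof.
move=> wt; rewrite /eval_terms (sum_regroup (g := fun l r => r *: M l)) // => [t0|l|l r s].
- rewrite /eval_model (sum_regroup (g := fun l r => iota r * model_monomial l)) => [|l|l r s].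
  + rewrite big_seq big1 // => l ls; case: hPAC => _ [_ _] H _ _.
    rewrite (H _ (fun l => \sum_(p <- t | p.2 == l) p.1) _ _ t0 l ls) ?iota0 ?mul0r //.
      exact: undup_uniq.
    apply/allP => a; rewrite mem_undup => /mapP[p pt ->].
    by move/allP: wt => /(_ _ pt).
  + by rewrite iota0 mul0r.
  + by rewrite iotaD mulrDl.
- exact: scale0r.
- exact: scalerDl.
Qed.

Definition terms_of (z : A) : terms := s2val (cid2 (eval_terms_surj hPAC z)).

Lemma wf_terms_of z : wf n (terms_of z).
Proof. exact: (s2valP (cid2 (eval_terms_surj hPAC z))). Qed.

Lemma eval_terms_of z : ev (terms_of z) = z.
Proof. by have := s2valP' (cid2 (eval_terms_surj hPAC z)). Qed.

Definition phi (z : A) : D := eval_model (terms_of z).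

Lemma phi_eval t : wf n t -> phi (ev t) = eval_model t.
Proof.
move=> wt; set u := terms_of (ev t).
(* In characteristic 2, two expressions of one element concatenate to an expression of 0. *)
have : eval_model (u ++ t) = 0.
  apply: eval_model_eq0; first by rewrite wf_terms_cat wf_terms_of.
  by rewrite eval_terms_cat eval_terms_of dg_two.
rewrite /eval_model big_cat -/(eval_model u) -/(eval_model t) => e.
by apply: (addIr (eval_model t)); rewrite tm_two.
Qed.

Lemma phiD z z' : phi (z + z') = phi z + phi z'.
Proof.
rewrite -{1}(eval_terms_of z) -{1}(eval_terms_of z') -eval_terms_cat phi_eval.
  exact: big_cat.
by rewrite wf_terms_cat !wf_terms_of.
Qed.

Lemma phi0 : phi 0 = 0.
Proof. by apply: (addrI (phi 0)); rewrite -phiD !addr0. Qed.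

Lemma phi_sum (I : Type) (s : seq I) (F : I -> A) :
  phi (\sum_(i <- s) F i) = \sum_(i <- s) phi (F i).
Proof. exact: (big_morph phi phiD phi0). Qed.

Lemma phiZ r z : phi (r *: z) = iota r * phi z.
Proof.
rewrite -{1}(eval_terms_of z) (_ : r *: _ = ev [seq (r * p.1, p.2) | p <- terms_of z]).
  rewrite phi_eval.
    rewrite /phi /eval_model big_map mulr_sumr; apply: eq_bigr => p _ /=.
    by rewrite iotaM mulrA.
  by rewrite /wf_terms all_map; apply: sub_all (wf_terms_of z).
rewrite /eval_terms big_map scaler_sumr; apply: eq_bigr => p _ /=.
by rewrite scalerA.
Qed.

Lemma phi_monomial a : gamma_exponent deg n a -> phi (M a) = model_monomial a.
Proof.
move=> ga; have := @phi_eval [:: (1, a)].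
rewrite /eval_terms /eval_model !big_seq1 /= scale1r iota1 mul1r; apply.
by rewrite /wf_terms /= ga.
Qed.

Lemma phi_monomialM a b : gamma_exponent deg n a -> gamma_exponent deg n b ->
  phi (M a * M b) = model_monomial a * model_monomial b.
Proof.
move=> ga gb; have sA := gamma_factor_system S_two hPAC.
have sD := model_factor_system.
(* If an odd variable occurs in both monomials, both products are 0. Otherwise the sum of the
   exponents is admissible and the same binomial coefficients appear on both sides. *)
have [/existsP[i /and3P[o /eqP ai /eqP bi]]|/existsPn good] :=
    boolP [exists i, [&& odd (deg i), a i == 1%N & b i == 1%N]].
  rewrite /model_monomial (gamma_system_eq0 sD o ai bi).
  rewrite (_ : M a * M b = 0); first exact: phi0.
  exact: (gamma_system_eq0 sA o ai bi).
rewrite /model_monomial (gamma_system_mul a b sD).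
have -> : M a * M b = M (expo_add a b) *+ gamma_binom deg a b.
  exact: (gamma_system_mul a b sA).
have phiMn z k : phi (z *+ k) = phi z *+ k.
  by elim: k => [|k IH]; rewrite ?mulr0n ?phi0 // !mulrS phiD IH.
rewrite phiMn phi_monomial //; apply/forallP => i; rewrite ffunE.
have /forallP/(_ i)/andP[a1 a2] := ga; have /forallP/(_ i)/andP[b1 b2] := gb.
have := good i; move: a1 a2 b1 b2.
by case: (odd _); case: (_ < _)%N => /=; lia.
Qed.

Lemma phi1 : phi 1 = 1.
Proof.
have [fD _ _] := model_factor_system.
have [fA _ _] := gamma_factor_system S_two hPAC.
have := @phi_monomial [ffun=> 0%N].
rewrite /model_monomial gamma_monomialE !big1 => [|i _|i _]; try by rewrite ffunE.
by apply; apply/forallP => i; rewrite ffunE !implybT.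
Qed.

Lemma phiM z z' : phi (z * z') = phi z * phi z'.
Proof.
rewrite -{1}(eval_terms_of z) -{1}(eval_terms_of z').
rewrite /eval_terms [in LHS]mulr_suml phi_sum.
rewrite -[RHS]/(eval_model (terms_of z) * eval_model (terms_of z')).
rewrite /eval_model [RHS]mulr_suml.
rewrite big_seq [RHS]big_seq; apply: eq_bigr => p pz.
rewrite [in LHS]mulr_sumr phi_sum [RHS]mulr_sumr.
rewrite big_seq [RHS]big_seq; apply: eq_bigr => q qz.
rewrite -scalerAl -scalerAr !phiZ phi_monomialM.
- by ring.
- by have /allP := wf_terms_of z; apply.
- by have /allP := wf_terms_of z'; apply.
Qed.

Definition expo_single i k : expo := [ffun j => if j == i then k else 0%N].

Lemma prod_single (R : comNzRingType) f i k : @gamma_system _ deg R f ->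
  \prod_j f j (expo_single i k j) = f i k.
Proof.
case=> f0 _ _; rewrite (bigD1 i) //= ffunE eqxx big1 ?mulr1 // => j /negbTE ji.
by rewrite ffunE ji.
Qed.

Lemma phi_factor i k : (odd (deg i) ==> (k <= 1)%N) ->
  phi (gamma_factor deg X i k) = model_factor i k.
Proof.
move=> ok; transitivity (model_monomial (expo_single i k)); last first.
  exact: prod_single model_factor_system.
rewrite -phi_monomial.
  congr phi; apply/esym; exact: (prod_single i k (gamma_factor_system S_two hPAC)).
apply/forallP => j; rewrite ffunE; case: eqP => [->|_]; last by rewrite !implybT.
by rewrite ok; case: hPAC => /(_ i) [/andP[_ di] _] _ _ _; rewrite ltnNge di.
Qed.

Lemma phi_d_monomial q a :
  (forall i, (deg i <= q)%N -> tm_d (y i) = phi (dg_d (X i))) ->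
  gamma_exponent deg n a -> gamma_exponent deg q a ->
  phi (dg_d (M a)) = tm_d (phi (M a)).
Proof.
move=> hy ga qa; have [dD dM dG] := tm_d_gder D.
rewrite /gamma_monomial.
apply: (big_ind (fun z => phi (dg_d z) = tm_d (phi z))).
- by rewrite dg_d1 phi0 phi1 (gder1 (tm_d_gder D)).
- by move=> z z' hz hz'; rewrite dg_leibniz2 // phiD !phiM hz hz' dM.
move=> i _; have /forallP/(_ i)/andP[oi _] := ga.
have /forallP/(_ i)/andP[_] := qa.
rewrite -/(gamma_factor deg X i (a i)); case: ltnP => /= [_ /eqP->|iq _].
  have [-> _ _] := gamma_factor_system S_two hPAC.
  by rewrite dg_d1 phi0 phi1 (gder1 (tm_d_gder D)).
have [/andP[i0 _] hi] : (0 < deg i <= n)%N /\ dg_hom (deg i) (X i) by case: hPAC.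
rewrite phi_factor // /gamma_factor /model_factor.
case: ifPn oi => o /=.
  case: (a i) => [|[|//]] _; first by rewrite !expr0 dg_d1 phi0 (gder1 (tm_d_gder D)).
  by rewrite !expr1 hy.
move=> _; case: (a i) => [|k].
  by rewrite tm_gp0 // (dg_dpow0 _ i0 hi) // dg_d1 phi0 (gder1 (tm_d_gder D)).
rewrite (dg_d_dpow _ _ i0 hi) // phiM -hy // dG //; congr (_ * _).
by have := @phi_factor i k; rewrite /gamma_factor /model_factor (negbTE o); apply.
Qed.

Lemma gamma_exponent_max q a : gamma_exponent deg q a -> gamma_exponent deg n a.
Proof.
move=> /forallP qa; apply/forallP => i; have /andP[-> _] := qa i.
by case: hPAC => /(_ i) [/andP[_ di] _] _ _ _; rewrite ltnNge di.
Qed.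

Lemma wf_terms_max q t : wf q t -> wf n t.
Proof. by apply: sub_all => p; apply: gamma_exponent_max. Qed.

Lemma phi_d q z :
  (forall i, (deg i <= q)%N -> tm_d (y i) = phi (dg_d (X i))) ->
  gamma_sub deg X q z -> phi (dg_d z) = tm_d (phi z).
Proof.
move=> hy /gamma_sub_terms[t wt ->].
have [dD dM _] := tm_d_gder D.
have dsum (s : terms) (F : S * expo -> D) :
    tm_d (\sum_(p <- s) F p) = \sum_(p <- s) tm_d (F p).
  exact: (big_morph (@tm_d D) dD (gder0 (tm_d_gder D))).
rewrite /eval_terms linear_sum !phi_sum dsum.
rewrite big_seq [RHS]big_seq; apply: eq_bigr => p pt.
have qp : gamma_exponent deg q p.2 by move/allP: wt; apply.
rewrite linearZ /= !phiZ (phi_d_monomial hy) ?(gamma_exponent_max qp) // dM.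
(* Scalars have degree 0, so their differentials lie in [tm_fil 0]. *)
rewrite (_ : tm_d (iota p.1) = 0) ?mul0r ?add0r //.
by apply: tm_fil_eq0; apply: tm_fil_d.
Qed.

Hypothesis y_fil : forall i, tm_fil (deg i).+1 (y i).

Lemma model_factor_fil i k : tm_fil (k * deg i).+1 (model_factor i k).
Proof.
rewrite /model_factor; case: ifP => o; last exact: tm_fil_gp.
elim: k => [|k IH]; first exact: tm_fil1.
by rewrite exprS mulSn; apply: tm_filM.
Qed.

Lemma phi_fil q z : dg_hom q z -> tm_fil q.+1 (phi z).
Proof.
move=> /(hom_terms S_two hPAC)[t [wt -> wq]]; rewrite phi_eval //.
apply: tm_fil_sum => p pt; rewrite -[q](wq p pt) -[(weight _ _).+1]/((0 + _).+1).
apply: tm_filM => //; apply: tm_fil_prod => i; exact: model_factor_fil.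
Qed.

Lemma phi_eps q z : (0 < q)%N -> dg_hom q z -> tm_eps (phi z) = false.
Proof.
move=> q0 /(hom_terms S_two hPAC)[t [wt -> wq]]; rewrite phi_eval //.
apply: tm_eps_sum => p pt; rewrite tm_epsM; apply/negbTE; rewrite negb_and.
case: (pickP (fun i => p.2 i != 0%N)) => [i pi|h0]; last first.
  move: q0; rewrite -(wq p pt) /weight big1 // => i _.
  by have /negbT := h0 i; rewrite negbK => /eqP ->.
apply/orP; right; rewrite /model_monomial (bigD1 i) //= tm_epsM negb_and.
apply/orP; left; rewrite /model_factor; case: (p.2 i) pi => // k _.
by case: ifP => o; rewrite ?tm_eps_gp // exprS tm_epsM y_eps.
Qed.

(* For degree reasons such a derivation kills the scalars and the variables. *)
Lemma chain_derivation_phi r (t : D -> D) z :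
  (n < r)%N -> chain_derivation r t -> t (phi z) = 0.
Proof.
move=> nr [dt _ ft]; have [tD tM tG] := dt.
have t0 x : tm_fil r x -> t x = 0 by move=> fx; apply/tm_fil_eq0/ft.
have ti i : t (y i) = 0.
  apply: t0; apply: tm_fil_le (y_fil i).
  by case: hPAC => /(_ i) [/andP[_ di] _] _ _ _; apply: leq_ltn_trans nr.
have tfac i k : t (model_factor i k) = 0.
  rewrite /model_factor; case: ifP => o.
    elim: k => [|k IH]; first by rewrite expr0 (gder1 dt).
    by rewrite exprS tM ti IH mul0r mulr0 addr0.
  case: k => [|k]; first by rewrite tm_gp0 // (gder1 dt).
  by rewrite tG // ti mul0r.
rewrite /phi /eval_model; apply: (big_ind (fun x => t x = 0)).
- exact: gder0 dt.
- by move=> a b ha hb; rewrite tD ha hb addr0.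
move=> p _; rewrite tM t0 ?mul0r ?add0r; last first.
  by apply: tm_fil_le (iota_fil _); apply: leq_ltn_trans nr.
rewrite (_ : t (model_monomial p.2) = 0) ?mulr0 //.
apply: (big_ind (fun x => t x = 0)) => [|a b ha hb|i _]; first exact: gder1 dt.
  by rewrite tM ha hb mul0r mulr0 addr0.
exact: tfac.
Qed.

End Phi.

(** Allows the images of the variables to be chosen degree by degree: later choices do not change
    the map on the subalgebra already treated. *)
Lemma phi_agree q (y y' : 'I_N -> D) z :
  (forall i, tm_eps (y i) = false) -> (forall i, tm_eps (y' i) = false) ->
  (forall i, (deg i <= q)%N -> y i = y' i) ->
  gamma_sub deg X q z -> phi y z = phi y' z.
Proof.
move=> ey ey' yy' /gamma_sub_terms[t wt ->].
rewrite !phi_eval ?(wf_terms_max wt) //.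
rewrite /eval_model big_seq [RHS]big_seq; apply: eq_bigr => p pt; congr (_ * _).
apply: eq_bigr => i _; rewrite /model_factor.
have /forallP/(_ i)/andP[_] : gamma_exponent deg q p.2 by move/allP: wt; apply.
case: leqP => /= [iq _|_ /eqP ->]; first by rewrite yy'.
by case: ifP => o; rewrite ?expr0 // !tm_gp0.
Qed.

(** A variable of degree q + 1 goes to the contraction of the image of its boundary. That image is a
    cycle of augmentation 0, so the homotopy makes it the differential of this choice. *)
Lemma ex_model_variables : exists y : 'I_N -> D,
  [/\ forall i, tm_eps (y i) = false, forall i, tm_fil (deg i).+1 (y i) &
      forall i, tm_d (y i) = phi y (dg_d (X i))].
Proof.
suff [y [ey fy dy]] : exists y : 'I_N -> D,
    [/\ forall i, tm_eps (y i) = false, forall i, tm_fil (deg i).+1 (y i) &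
        forall i, (deg i <= n)%N -> tm_d (y i) = phi y (dg_d (X i))].
  exists y; split=> // i; apply: dy.
  by case: hPAC => /(_ i) [/andP[]].
(* The induction is on the degree up to which differentials are respected; the closure itself stays
   fixed. *)
elim: n => [|q [y [ey fy dy]]].
  exists (fun=> 0); split=> [i|i|i]; [exact: tm_eps0|exact: tm_fil0|].
  by case: hPAC => /(_ i) [/andP[i0 _] _] _ _ _; rewrite leqNgt i0.
have dX_hom i : dg_hom (deg i).-1 (dg_d (X i)).
  case: hPAC => /(_ i) [/andP[i0 _] hi] _ _ _.
  by apply: dg_d_homS; rewrite prednK.
have dX_sub i : (deg i <= q.+1)%N -> gamma_sub deg X q (dg_d (X i)).
  case: hPAC => /(_ i) [/andP[i0 _] hi] _ _ _ iq.
  have /(hom_terms S_two hPAC)[t [wt -> wq]] := dX_hom i.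
  apply/gamma_sub_terms; exists t => //; apply/allP => p pt.
  apply: weight_exponent; first by move/allP: wt; apply.
  by rewrite (wq p pt); lia.
pose y' i := if (deg i == q.+1) then tm_s (phi y (dg_d (X i))) else y i.
have ey' i : tm_eps (y' i) = false.
  by rewrite /y'; case: ifP => // _; apply: tm_eps_s.
have yy' i : (deg i <= q)%N -> y i = y' i.
  by move=> iq; rewrite /y'; case: eqP => // e; move: iq; rewrite e ltnn.
exists y'; split=> // [i|i iq].
  rewrite /y'; case: ifP => // _; apply: tm_fil_s.
  have := phi_fil ey fy (dX_hom i).
  by case: hPAC => /(_ i) [/andP[i0 _] hi] _ _ _; rewrite prednK.
rewrite -(phi_agree ey ey' yy' (dX_sub i iq)) /y'; case: eqP => di; last first.
  by apply: dy; lia.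
have := tm_homotopy (phi y (dg_d (X i))).
rewrite -(phi_d ey dy (dX_sub i iq)) dg_dd phi0 //.
rewrite tm_s0 addr0 (_ : tm_eps _ = false) ?addr0 //.
(* The augmentation vanishes because the boundary lies in m when the variable has degree 1, and has
   positive degree otherwise. *)
have [i1|i1] := leqP (deg i) 1%N.
  case: hPAC => /(_ i) [/andP[i0 _] hi] _ [f [fX [[fm _] _]]] _.
  have {i1} i1 : deg i = 1%N by lia.
  by rewrite fX // phiZ // phi1 // mulr1; apply: iota_eps; apply: fm; apply/eqP.
by apply: (phi_eps ey _ (dX_hom i)); lia.
Qed.

Lemma comparison_map : exists f : A -> D,
  [/\ forall x z, f (x + z) = f x + f z,
      forall r z, f (r *: z) = iota r * f z,
      forall x z, f (x * z) = f x * f z,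
      f 1 = 1 &
      [/\ forall z, f (dg_d z) = tm_d (f z),
          forall q z, dg_hom q z -> tm_fil q.+1 (f z),
          forall q z, (0 < q)%N -> dg_hom q z -> tm_eps (f z) = false &
          forall r t z, (n < r)%N -> chain_derivation r t -> t (f z) = 0]].
Proof.
have [y [ey fy dy]] := ex_model_variables.
exists (phi y); split; [exact: phiD|exact: phiZ|exact: phiM|exact: phi1|split].
- move=> z; apply: (phi_d (q := n) ey) => //.
  apply/gamma_sub_terms; have [t wt zt] := eval_terms_surj hPAC z.
  by exists t.
- by move=> q z; apply: phi_fil.
- by move=> q z; apply: phi_eps.
- by move=> r t z; apply: chain_derivation_phi.
Qed.

End Comparison.

(** * The obstruction to a trivial Massey operation *)

Section Obstruction.
Variable D : tate_model.

Lemma tm_cycle (u : D) : tm_d u = 0 -> u = tm_d (tm_s u) + (tm_eps u)%:R.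
Proof.
move=> du; have := tm_homotopy u; rewrite du tm_s0 addr0 => ->.
by rewrite -addrA tm_two addr0.
Qed.

(** A cycle is a boundary up to a constant 0 or 1, and derivations kill constants. *)
Lemma chain_derivation_cycle r (t : D -> D) u : chain_derivation r t ->
  tm_d u = 0 -> t u = tm_d (t (tm_s u)).
Proof.
move=> [dt td _] /tm_cycle {1}->; have [tD _ _] := dt; rewrite tD td.
by case: (tm_eps u); rewrite ?(gder1 dt) ?(gder0 dt) addr0.
Qed.

(* If d w = (d t1) (d t2), then w + t1 (d t2) bounds some v, and evaluating
   two commuting derivations on v in both orders gives different values. *)
Lemma product_obstruction r (a b : D -> D) (w t1 t2 : D) :
  (0 < r)%N -> chain_derivation r a -> chain_derivation r b ->
  (forall x, a (b x) = b (a x)) -> a w = 0 -> b w = 0 ->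
  tm_fil r.+1 t1 -> tm_fil r.+1 t2 ->
  tm_eps (a t1) -> tm_eps (b t2) -> tm_eps (b t1) = false ->
  tm_d w <> tm_d t1 * tm_d t2.
Proof.
move=> r0 ha hb ab aw bw f1 f2 a1 b2 b1 dw.
have [dD dM _] := tm_d_gder D.
set u := w + t1 * tm_d t2.
have du : tm_d u = 0 by rewrite dD dM tm_dd mulr0 addr0 dw tm_two.
(* With v = [tm_s u], this evaluates c' c v for both orders of the two derivations. *)
have E c c' : chain_derivation r c -> chain_derivation r c' -> c w = 0 ->
    tm_eps (c' (c (tm_s u))) = tm_eps (c t1) && tm_eps (c' t2).
  move=> hc hc' cw; have [dc cd fc] := hc; have [dc' c'd fc'] := hc'.
  have [cD cM _] := dc; have [c'D c'M _] := dc'.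
  have fil1 t : tm_fil r.+1 t -> tm_fil 1 (c t).
    by rewrite -add1n; apply: fc.
  have d0 t : tm_fil r.+1 t -> tm_d (c t) = 0.
    by move=> ft; apply/tm_fil_eq0/tm_fil_d/fil1.
  (* Here d (c t1) and c (d t2) vanish for degree reasons, and d (c v) = c u. So both summands have
     boundary c t1 * d t2. *)
  have p0 : tm_d (c t1 * t2 + c (tm_s u)) = 0.
    rewrite dD dM (d0 _ f1) mul0r add0r -(chain_derivation_cycle hc du).
    by rewrite /u cD cM cd (d0 _ f2) mulr0 addr0 cw add0r tm_two.
  (* The image of the cycle under c' is a boundary, of augmentation 0. As c' (c t1) = 0 by degree,
     this image is c t1 * c' t2 + c' c v. *)
  have := tm_eps_d (c' (tm_s (c t1 * t2 + c (tm_s u)))).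
  rewrite -(chain_derivation_cycle hc' p0) c'D c'M.
  rewrite (_ : c' (c t1) = 0) ?mul0r ?add0r; last first.
    by apply/tm_fil_eq0/fc'; apply: tm_fil_le (fil1 _ f1).
  by rewrite tm_epsD tm_epsM; case: (_ && _); case: (tm_eps _).
(* Applying a first gives augmentation 1, applying b first gives 0. *)
by have := E a b ha hb aw; rewrite -ab (E b a hb ha bw) a1 b2 b1.
Qed.

End Obstruction.

(** * Lifting chains to the partial acyclic closure *)

Section NotGolod.
Variables (S : comNzRingType) (m : set S).
Hypothesis S_two : forall r : S, r + r = 0.
Variables (D : tate_model) (iota : S -> D).
Hypothesis iotaD : forall r s, iota (r + s) = iota r + iota s.
Hypothesis iotaM : forall r s, iota (r * s) = iota r * iota s.
Hypothesis iota1 : iota 1 = 1.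
Hypothesis iota_fil : forall r, tm_fil 1 (iota r).
Hypothesis iota_eps : forall r, m r -> tm_eps (iota r) = false.

(* Elements with d (e k.+1) = x_k e_k, as given by the words x_(k-1) ... x_0. *)
Definition tate_chain (x : nat -> S) (e : nat -> D) : Prop :=
  [/\ e 0%N = 1, forall k, tm_d (e k.+1) = iota (x k) * e k,
      forall k, tm_fil k.+1 (e k), forall k, tm_eps (e k.+1) = false &
      (forall k, m (x k)) /\ forall k, x k.+1 * x k = 0].

Variables (A : dgGammaAlgebra S) (N : nat) (deg : 'I_N -> nat) (X : 'I_N -> A).
Variable n : nat.
Hypothesis hPAC : is_partial_acyclic_closure m deg X n.
Variable f : A -> D.
Hypothesis fZ : forall r z, f (r *: z) = iota r * f z.
Hypothesis f1 : f 1 = 1.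
Hypothesis fd : forall z, f (dg_d z) = tm_d (f z).
Hypothesis f_fil : forall q z, dg_hom q z -> tm_fil q.+1 (f z).
Hypothesis f_eps : forall q z, (0 < q)%N -> dg_hom q z -> tm_eps (f z) = false.

(** The e_k are lifted degree by degree. The image of a lift p agrees with e_k up to a boundary only
    after multiplication by x_k, since the correction x_(k-1) h from the previous stage is killed by
    x_k. Exactness is available below degree n, so in degree n the process stops with the cycle x_n
    p. *)
Lemma lift_chain x e : tate_chain x e -> exists2 z : A,
  dg_hom n z /\ dg_d z = 0 &
  exists2 h, tm_fil n.+2 h & f z = tm_d (e n.+1 + iota (x n) * h).
Proof.
move=> [e0 de fe ee [mx xx]]; have [dD dM _] := tm_d_gder D.
have d_iota r : tm_d (iota r) = 0 by apply/tm_fil_eq0/tm_fil_d.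
have ixx k : iota (x k.+1) * iota (x k) = 0.
  by rewrite -iotaM xx; apply: (addrI (iota 0)); rewrite -iotaD !addr0.
suff /(_ n (leqnn n)) [p [hp dp _ [h fh fp]]] : forall k, (k <= n)%N ->
    exists p : A, [/\ dg_hom k p, x k *: dg_d p = 0, k = 0%N -> p = 1 &
      exists2 h, tm_fil k.+2 h & iota (x k) * f p = iota (x k) * (e k + tm_d h)].
  exists (x n *: p); first by rewrite linearZ; split=> //; apply: dg_homZ.
  by exists h => //; rewrite fZ fp mulrDr dD de dM d_iota mul0r add0r.
elim=> [_|k IH kn].
  exists 1; split=> //; [exact: dg_hom1|by rewrite dg_d1 scaler0|].
  exists 0; first exact: tm_fil0.
  by rewrite f1 e0 (gder0 (tm_d_gder D)) addr0.
have [p [hp dp p1 [h fh fp]]] := IH (ltnW kn).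
have [q hq dq] : exists2 q : A, dg_hom k.+1 q & dg_d q = x k *: p.
  case: k kn {IH fh fp} hp dp p1 => [|k] kn hp dp p1.
    by rewrite p1 //; apply: (exact_degree0 hPAC).
  by apply: (exact_degree S_two hPAC); rewrite ?linearZ //; apply: dg_homZ.
(* The defect of the lift [q] is a cycle of augmentation 0, hence the boundary of [tm_s v]. *)
pose v := f q + e k.+1 + iota (x k) * h.
have dv : tm_d v = 0.
  rewrite /v !dD -fd dq fZ fp de dM d_iota mul0r add0r mulrDr.
  by rewrite -addrA tm_two.
have ev : tm_eps v = false.
  rewrite /v !tm_epsD (f_eps _ hq) // ee tm_epsM iota_eps //.
exists q; split=> //.
  by rewrite dq scalerA xx scale0r.
exists (tm_s v).
  apply: tm_fil_s; apply: tm_filD; first by apply: tm_filD; [exact: f_fil|exact: fe].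
  by rewrite -[k.+1]add0n; apply: tm_filM.
have /esym := tm_cycle dv; rewrite ev addr0 => ->.
rewrite /v mulrDr [in RHS]mulrDr !mulrDr mulrA ixx mul0r addr0.
by rewrite addrCA tm_two addr0.
Qed.

(** The values of the Massey operation on sequences of length 1 and 2 make products of cycles of
    degree n boundaries. For the lifts of the two chains this contradicts [product_obstruction]. *)
Lemma not_golod x e x' e' a b : (0 < n)%N ->
  tate_chain x e -> tate_chain x' e' ->
  chain_derivation n.+1 a -> chain_derivation n.+1 b ->
  (forall u, a (b u) = b (a u)) ->
  tm_eps (a (e n.+1)) -> tm_eps (b (e n.+1)) = false -> tm_eps (b (e' n.+1)) ->
  (forall y z, f (y + z) = f y + f z) ->
  (forall y z, f (y * z) = f y * f z) ->
  (forall r t z, (n < r)%N -> chain_derivation r t -> t (f z) = 0) ->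
  ~ is_golod_algebra m A.
Proof.
move=> n0 ce ce' ha hb ab a1 b1 b2 fD fM f0 [_ [L [dl [h [mu [bar [dl0 hH hmu hbar dmu]]]]]]].
have [z [zn dz] [g fg fz]] := lift_chain ce.
have [z' [zn' dz'] [g' fg' fz']] := lift_chain ce'.
have barE y : bar y = y.
  have [p [c [hc ->]]] := dg_hom_span y; rewrite linear_sum; apply: eq_bigr => i _.
  have n1 : -1 = 1 :> S by apply: (addrI 1); rewrite subrr S_two.
  by rewrite (hbar i) // n1 expr1n scale1r.
pose B (y : A) := exists c, y = dg_d c.
have BD y y' : B y -> B y' -> B (y + y').
  by move=> [c ->] [c' ->]; exists (c + c'); rewrite linearD.
have BZ r y : B y -> B (r *: y).
  by move=> [c ->]; exists (r *: c); rewrite linearZ.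
have BM y u : B y -> dg_d u = 0 -> B (y * u).
  by move=> [c ->] du; exists (c * u); rewrite dg_leibniz2 // du mulr0 addr0.
have Bsum (s : seq L) (F : L -> A) : (forall l, l \in s -> B (F l)) ->
    B (\sum_(l <- s) F l).
  move=> BF; rewrite big_seq; apply: (big_ind B) => //; first by exists 0; rewrite linear0.
have h_cycle l : dg_d (h l) = 0.
  by have [/(_ l (eqxx _)) []] := hH _ (dl0 l).
have Bhh l l' : B (h l * h l').
  have [d1 b1'] := hmu l; have [d2 b2'] := hmu l'.
  (* Representatives of a class differ by a boundary, and a boundary times a cycle is a boundary. *)
  have -> : h l * h l' = mu [:: l] * mu [:: l'] + (mu [:: l] - h l) * mu [:: l']
      + (mu [:: l'] - h l') * h l.
    rewrite !(dg_opp S_two) !mulrDl (dg_mul_comm S_two (h l') (h l)).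
    rewrite (dg_mul_comm S_two (mu [:: l']) (h l)).
    by rewrite !addrA (dg_two S_two) add0r (dg_two S_two) add0r.
  apply: (BD); last by exact: BM.
  apply: (BD); last by exact: BM.
  by exists (mu [:: l; l']); rewrite dmu // big_ltn // big_geq // addr0 /= barE.
have decomp y : dg_hom n y -> dg_d y = 0 -> exists s r,
    B (y + \sum_(l <- s) r l *: h l).
  move=> hy dy; have [_ /(_ y (conj hy dy)) [s [r [_ hB]]] _] := hH n n0.
  by exists s, r; rewrite -[X in B (_ + X)](dg_opp S_two).
have [w dw] : B (z * z').
  have [s [r hs]] := decomp z zn dz; have [s' [r' hs']] := decomp z' zn' dz'.
  have move_left (y y' : A) : y = (y + y') + y' by rewrite -addrA dg_two // addr0.
  rewrite (move_left z (\sum_(l <- s) r l *: h l)) mulrDl; apply: (BD); first exact: BM.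
  rewrite mulr_suml; apply: (Bsum) => l _; rewrite -scalerAl; apply: (BZ).
  rewrite dg_mul_comm // (move_left z' (\sum_(l <- s') r' l *: h l)) mulrDl.
  apply: (BD); first exact: BM.
  by rewrite mulr_suml; apply: (Bsum) => l' _; rewrite -scalerAl; apply: (BZ).
have iota_xe (u : nat -> S) (v : nat -> D) g0 : tate_chain u v -> tm_fil n.+2 g0 ->
    tm_fil n.+2 (v n.+1 + iota (u n) * g0).
  move=> [_ _ fv _ _] fg0; apply: tm_filD => //.
  by rewrite -[n.+1]add0n; apply: tm_filM.
(* The correction term does not affect augmentations: the derivation kills scalars, and x_n itself
   has augmentation 0. *)
have eps_xe (u : nat -> S) (v : nat -> D) g0 c : tate_chain u v ->
    chain_derivation n.+1 c ->
    tm_eps (c (v n.+1 + iota (u n) * g0)) = tm_eps (c (v n.+1)).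
  move=> [_ _ _ _ [mu' _]] [[cD cM _] _ fc]; rewrite cD cM tm_epsD tm_epsD !tm_epsM.
  rewrite (iota_eps (mu' n)) (_ : c (iota _) = 0) ?tm_eps0 ?addbF //.
  by apply/tm_fil_eq0/fc; apply: tm_fil_le (iota_fil _).
apply: (product_obstruction (ltn0Sn n) ha hb ab _ _ (iota_xe _ _ _ ce fg)
  (iota_xe _ _ _ ce' fg') (w := f w)).
- exact: f0 ha.
- exact: f0 hb.
- by rewrite (eps_xe _ _ _ _ ce ha).
- by rewrite (eps_xe _ _ _ _ ce' hb).
- by rewrite (eps_xe _ _ _ _ ce hb).
- by rewrite -fz -fz' -fM dw fd.
Qed.

End NotGolod.

(** * Gorenstein rings of a cubic form *)

(** The symmetric trilinear form of X_p X_q X_r for distinct p, q, r, evaluated at basis vectors. *)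
Definition triple (p q r i j k : nat) : bool :=
  [|| (i == p) && ((j == q) && (k == r) || (j == r) && (k == q)),
      (i == q) && ((j == p) && (k == r) || (j == r) && (k == p)) |
      (i == r) && ((j == p) && (k == q) || (j == q) && (k == p))].

(* The coefficients of the symmetric trilinear form of
   X0 X2 X4 + X0 X3 X5 + X1 X2 X6 + X1 X3 X7 + X8^3 + X9^3 + ... *)
Definition cubic (i j k : nat) : bool :=
  [|| triple 0 2 4 i j k, triple 0 3 5 i j k, triple 1 2 6 i j k,
      triple 1 3 7 i j k | [&& 8 <= i, i == j & j == k]]%N.

Lemma triple_swap12 p q r i j k : triple p q r i j k = triple p q r j i k.
Proof.
rewrite /triple.
by do 9![case: (_ == _) => //=].
Qed.

Lemma triple_swap23 p q r i j k : triple p q r i j k = triple p q r i k j.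
Proof. by rewrite /triple; do 9![case: (_ == _) => //=]. Qed.

Lemma cubic_swap12 i j k : cubic i j k = cubic j i k.
Proof.
rewrite /cubic ![triple _ _ _ j i k]triple_swap12; do 4!congr (_ || _).
by rewrite [j == i]eq_sym; case: eqP => [->|] //=; rewrite !andbF.
Qed.

Lemma cubic_swap23 i j k : cubic i j k = cubic i k j.
Proof.
rewrite /cubic ![triple _ _ _ i k j]triple_swap23; do 4!congr (_ || _).
congr (_ && _); rewrite [k == j]eq_sym.
by case: (j =P k) => [->|]; rewrite ?andbT ?andbF.
Qed.

(* A basis of k + V + V^* + W + k: the ring structure below is given by a cubic
   form V x V -> V^*, the pairing V x V^* -> k and the dot product on W; [pu]
   is the unit and [ps] spans the socle. *)
Inductive pos (n e : nat) : Type :=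
  pv of 'I_n | pd of 'I_n | pw of 'I_e | pu | ps.
Arguments pv {n e}.
Arguments pd {n e}.
Arguments pw {n e}.
Arguments pu {n e}.
Arguments ps {n e}.

Section Pos.
Variables n e : nat.
Definition pos_code (p : pos n e) : 'I_n + 'I_n + 'I_e + bool :=
  match p with
  | pv i => inl (inl (inl i)) | pd i => inl (inl (inr i)) | pw j => inl (inr j)
  | pu => inr true | ps => inr false
  end.
Definition pos_decode (c : 'I_n + 'I_n + 'I_e + bool) : pos n e :=
  match c with
  | inl (inl (inl i)) => pv i | inl (inl (inr i)) => pd i | inl (inr j) => pw j
  | inr b => if b then pu else ps
  end.
Lemma pos_codeK : cancel pos_code pos_decode.
Proof. by case. Qed.
HB.instance Definition _ := Finite.copy (pos n e) (can_type pos_codeK).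
End Pos.

Definition gor (K : comNzRingType) (n e : nat) : Type := {ffun pos n e -> K}.

Section GorRing.
Variables (K : comNzRingType) (n e : nat).
Local Notation T := (gor K n e).
HB.instance Definition _ := GRing.Zmodule.copy T {ffun pos n e -> K}.
Implicit Types x y z : T.

Definition cub x y (k : 'I_n) : K :=
  \sum_(i < n) \sum_(j < n) (cubic i j k)%:R * (x (pv i) * y (pv j)).

Definition dotvd x y : K := \sum_(i < n) x (pv i) * y (pd i).
Definition dotww x y : K := \sum_(j < e) x (pw j) * y (pw j).

Definition gor_mul x y : T := [ffun p => match p with
  | pv i => x pu * y (pv i) + y pu * x (pv i)
  | pd i => x pu * y (pd i) + y pu * x (pd i) + cub x y i
  | pw j => x pu * y (pw j) + y pu * x (pw j)
  | pu => x pu * y pu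
  | ps => x pu * y ps + y pu * x ps + dotvd x y + dotvd y x + dotww x y
  end].

Definition gor_one : T := [ffun p => (p == pu)%:R].

Lemma cubC x y k : cub x y k = cub y x k.
Proof.
rewrite /cub exchange_big; apply: eq_bigr => i _; apply: eq_bigr => j _.
by rewrite cubic_swap12 [_ * y _]mulrC.
Qed.

Lemma dotww_C x y : dotww x y = dotww y x.
Proof. by apply: eq_bigr => j _; rewrite mulrC. Qed.

Fact gor_mulC : commutative gor_mul.
Proof.
move=> x y; apply/ffunP => p; rewrite !ffunE; case: p => [i|i|j||].
- by rewrite addrC.
- by rewrite cubC [x pu * _ + _]addrC.
- by rewrite addrC.
- by rewrite mulrC.
- by rewrite dotww_C addrAC -!addrA [dotvd x y + _]addrCA; ring.
Qed.

Lemma cub_mul x y z k :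
  cub (gor_mul x y) z k = x pu * cub y z k + y pu * cub x z k.
Proof.
rewrite /cub !mulr_sumr -big_split; apply: eq_bigr => i _ /=.
rewrite !mulr_sumr -big_split; apply: eq_bigr => j _ /=.
by rewrite ffunE; ring.
Qed.

Definition cub3 x y z : K := \sum_(k < n) cub x y k * z (pv k).

Lemma cub3C x y z : cub3 x y z = cub3 y x z.
Proof. by apply: eq_bigr => k _; rewrite cubC. Qed.

Lemma cub3_rot x y z : cub3 x y z = cub3 x z y.
Proof.
have E u v w : cub3 u v w = \sum_(i < n) \sum_(j < n) \sum_(k < n)
    (cubic i j k)%:R * (u (pv i) * v (pv j) * w (pv k)).
  rewrite /cub3 /cub.
  under eq_bigr => k _ do rewrite mulr_suml.
  rewrite exchange_big; apply: eq_bigr => i _ /=.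
  under eq_bigr => k _ do rewrite mulr_suml.
  rewrite exchange_big; apply: eq_bigr => j _ /=.
  by apply: eq_bigr => k _; ring.
rewrite !E; apply: eq_bigr => i _; rewrite exchange_big.
apply: eq_bigr => j _; apply: eq_bigr => k _; rewrite cubic_swap23; ring.
Qed.

Lemma dotvd_mull x y z :
  dotvd (gor_mul x y) z = x pu * dotvd y z + y pu * dotvd x z.
Proof.
rewrite /dotvd !mulr_sumr -big_split; apply: eq_bigr => i _ /=.
by rewrite ffunE; ring.
Qed.

Lemma dotvd_mulr x y z : dotvd z (gor_mul x y)
  = x pu * dotvd z y + y pu * dotvd z x + cub3 x y z.
Proof.
rewrite /dotvd /cub3 !mulr_sumr -!big_split; apply: eq_bigr => i _ /=.
by rewrite ffunE; ring.
Qed.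

Lemma dotww_mul x y z :
  dotww (gor_mul x y) z = x pu * dotww y z + y pu * dotww x z.
Proof.
rewrite /dotww !mulr_sumr -big_split; apply: eq_bigr => i _ /=.
by rewrite ffunE; ring.
Qed.

(** A product of three vectors of V lies in the socle and is given by [cub3], so there associativity
    is the symmetry of the trilinear form. *)
Fact gor_mulA : associative gor_mul.
Proof.
move=> x y z; apply/ffunP => p; rewrite [LHS]ffunE [RHS]ffunE.
case: p => [i|i|j||]; rewrite ?[gor_mul x y _]ffunE ?[gor_mul y z _]ffunE.
- ring.
- by rewrite [cub x _ _]cubC !cub_mul (cubC z) (cubC y x); ring.
- ring.
- ring.
rewrite [dotww x _]dotww_C !dotww_mul !dotvd_mull !dotvd_mulr.
rewrite (dotww_C z x) (dotww_C y x) (cub3C y z x) (cub3_rot z y x).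
rewrite (cub3C z x y) (cub3_rot x z y); ring.
Qed.

Fact gor_mul1 : left_id gor_one gor_mul.
Proof.
move=> x; apply/ffunP => p; rewrite ffunE.
have c0 k : cub gor_one x k = 0.
  by rewrite /cub big1 // => i _; rewrite big1 // => j _; rewrite ffunE mul0r mulr0.
have d0 : dotvd gor_one x = 0 by rewrite /dotvd big1 // => i _; rewrite ffunE mul0r.
have d1 : dotvd x gor_one = 0 by rewrite /dotvd big1 // => i _; rewrite ffunE mulr0.
have w0 : dotww gor_one x = 0 by rewrite /dotww big1 // => i _; rewrite ffunE mul0r.
case: p => [i|i|j||]; rewrite ?c0 ?d0 ?d1 ?w0 !ffunE /=; ring.
Qed.

Fact gor_mulD : left_distributive gor_mul +%R.
Proof.
move=> x y z; apply/ffunP => p; rewrite !ffunE.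
have c0 k : cub (x + y) z k = cub x z k + cub y z k.
  rewrite /cub -big_split; apply: eq_bigr => i _; rewrite -big_split.
  by apply: eq_bigr => j _ /=; rewrite ffunE; ring.
have d0 : dotvd (x + y) z = dotvd x z + dotvd y z.
  by rewrite /dotvd -big_split; apply: eq_bigr => i _ /=; rewrite ffunE; ring.
have d1 : dotvd z (x + y) = dotvd z x + dotvd z y.
  by rewrite /dotvd -big_split; apply: eq_bigr => i _ /=; rewrite ffunE; ring.
have w0 : dotww (x + y) z = dotww x z + dotww y z.
  by rewrite /dotww -big_split; apply: eq_bigr => i _ /=; rewrite ffunE; ring.
by case: p => [i|i|j||]; rewrite ?c0 ?d0 ?d1 ?w0 ?ffunE; ring.
Qed.

Fact gor_one_neq0 : gor_one != 0.
Proof.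
by apply/eqP => /(congr1 (fun x : T => x pu)) /eqP; rewrite !ffunE oner_eq0.
Qed.

HB.instance Definition _ := GRing.Zmodule_isComNzRing.Build T
  gor_mulA gor_mulC gor_mul1 gor_mulD gor_one_neq0.

End GorRing.

(** * Chain conditions for finite rings *)

Lemma finite_noetherian (R : comNzRingType) (s : seq R) :
  (forall x, x \in s) -> noetherian R.
Proof.
move=> hs I [I0 ID IM].
(* All elements of I serve as generators; entries of [s] outside I are replaced by 0. *)
pose g (i : 'I_(size s)) := if `[< I s`_i >] then s`_i else 0.
have gI i : I (g i) by rewrite /g; case: asboolP.
exists (size s), g; apply/seteqP; split=> x /=.
  move=> Ix; have xs : (index x s < size s)%N by rewrite index_mem.
  exists (fun i => (i == Ordinal xs)%:R).
  rewrite (bigD1 (Ordinal xs)) //= eqxx mul1r big1 => [|i /negbTE ->].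
    by rewrite addr0 /g nth_index //; case: asboolP.
  by rewrite mul0r.
move=> [r ->]; apply: (big_ind I) => // i _; exact: IM.
Qed.

(** The chain is stationary from an index at which the number of entries of [s] in the ideal is
    least. *)
Lemma finite_artinian (R : comNzRingType) (s : seq R) :
  (forall x, x \in s) -> artinian R.
Proof.
move=> hs I _ dec.
have decS p q x : I (p + q)%N x -> I p x.
  by elim: q => [|q IH]; rewrite ?addn0 // addnS => /dec/IH.
pose c i := count (fun x => `[< I i x >]) s.
have exk : exists k, `[< exists i, c i = k >].
  by exists (c 0%N); apply/asboolP; exists 0%N.
case: (ex_minnP exk) => _ /asboolP[p <-] pmin; exists p => i pi.
have sub x : I i x -> I p x by rewrite -(subnKC pi); apply: decS.
apply/seteqP; split=> // x Ipx; apply: contrapT => nIx.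
have : (c p <= c i)%N by apply: pmin; apply/asboolP; exists i.
rewrite leqNgt => /negP; apply; rewrite /c.
have := hs x.
have cle t :
    (count (fun x => `[< I i x >]) t <= count (fun x => `[< I p x >]) t)%N.
  by apply: sub_count => y /asboolP/sub/asboolP.
elim: s {hs c exk pmin} => // y t IH; rewrite inE /=; case: eqP => [<- _|_ /= xt].
  by rewrite !(asboolT Ipx) (asboolF nIx) add0n add1n ltnS.
have := IH xt; have : (`[< I i y >] <= `[< I p y >])%N.
  by case: (asboolP (I i y)) => // /sub h; rewrite asboolT.
by move=> h1 h2; rewrite -addnS leq_add.
Qed.

(* Locked, since deciding that two basis vectors differ is a slow conversion. *)
HB.lock Definition gor_basis n e (p : pos n e) : gor bool n e := [ffun q => q == p].

(** * Coordinates and the socle pairing *)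

Section Gor.
Variables n e : nat.
Local Notation T := (gor bool n e).
Implicit Types (x y z s t : T) (p q : pos n e).

Lemma gor_two x : x + x = 0.
Proof. by apply/ffunP => p; rewrite !ffunE; case: (x p). Qed.

Lemma gor_mulE x y p : (x * y) p = gor_mul x y p.
Proof. by []. Qed.

Lemma gor_unit x y : (x * y) pu = x pu * y pu.
Proof. by rewrite gor_mulE ffunE. Qed.

Lemma gor_mul_v x y i :
  (x * y) (pv i) = x pu && y (pv i) (+) y pu && x (pv i).
Proof. by rewrite gor_mulE ffunE. Qed.

Lemma gor_mul_d x y i :
  (x * y) (pd i) = x pu && y (pd i) (+) y pu && x (pd i) (+) cub x y i.
Proof. by rewrite gor_mulE ffunE. Qed.

Lemma gor_mul_w x y j :
  (x * y) (pw j) = x pu && y (pw j) (+) y pu && x (pw j).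
Proof. by rewrite gor_mulE ffunE. Qed.

Lemma gor_mul_s x y : (x * y) ps
  = x pu && y ps (+) y pu && x ps (+) dotvd x y (+) dotvd y x (+) dotww x y.
Proof. by rewrite gor_mulE ffunE. Qed.

Lemma gor_mul_u x y : (x * y) pu = x pu && y pu.
Proof. by rewrite gor_mulE ffunE. Qed.

Definition gor_mul_coord := (gor_mul_v, gor_mul_d, gor_mul_w, gor_mul_u, gor_mul_s).

Lemma gor_basisE p q : gor_basis p q = (q == p).
Proof. by rewrite gor_basis.unlock ffunE. Qed.

Lemma gor_sum_basis x : x = \sum_(p | x p) gor_basis p.
Proof.
apply/ffunP => q; rewrite sum_ffunE.
under eq_bigr => p _ do rewrite gor_basisE.
rewrite big_mkcond (bigD1 q) //= eqxx big1 => [|p /negbTE pq].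
  by rewrite addr0; case: (x q).
by rewrite eq_sym pq if_same.
Qed.

(** Indexes the dual basis for the bilinear form sending (x, y) to [(x * y) ps]. *)
Definition gor_dual p : pos n e := match p with
  | pv i => pd i | pd i => pv i | pw j => pw j | pu => ps | ps => pu end.

Lemma gor_dualK : involutive gor_dual.
Proof. by case=> [i|i|j||]. Qed.

Lemma sum_pick (I : finType) (i : I) (F : I -> bool) (G : I -> bool) :
  (forall j, F j = (j == i) && G j) -> \sum_j F j = G i.
Proof.
move=> hF; rewrite (bigD1 i) //= hF eqxx big1 ?addr0 // => j /negbTE ji.
by rewrite hF ji.
Qed.

Lemma dotvd_basisl p x : dotvd (gor_basis p) x = if p is pv i then x (pd i) else 0.
Proof.
rewrite /dotvd; case: p => [i|i|j||].
2-5: by rewrite big1 // => k _; rewrite gor_basisE mul0r.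
by rewrite (sum_pick (i := i) (G := fun k => x (pd k))) // => j; rewrite gor_basisE.
Qed.

Lemma dotvd_basisr p x : dotvd x (gor_basis p) = if p is pd i then x (pv i) else 0.
Proof.
rewrite /dotvd; case: p => [i|i|j||].
1,3-5: by rewrite big1 // => k _; rewrite gor_basisE mulr0.
by rewrite (sum_pick (i := i) (G := fun k => x (pv k))) // => j; rewrite gor_basisE andbC.
Qed.

Lemma dotww_basis p x : dotww (gor_basis p) x = if p is pw j then x (pw j) else 0.
Proof.
rewrite /dotww; case: p => [i|i|j||].
1,2,4,5: by rewrite big1 // => k _; rewrite gor_basisE mul0r.
by rewrite (sum_pick (i := j) (G := fun k => x (pw k))) // => k; rewrite gor_basisE.
Qed.

Lemma gor_socle_basis p x : (gor_basis p * x) ps = x (gor_dual p).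
Proof.
rewrite gor_mul_s dotvd_basisl dotvd_basisr dotww_basis !gor_basisE.
by case: p => [i|i|j||]; rewrite /= ?andbF ?andbT ?addbF.
Qed.

(** The socle form is nondegenerate; this is the source of the Gorenstein property. *)
Lemma gor_eqP x y : (forall s, (s * x) ps = (s * y) ps) -> x = y.
Proof.
move=> h; apply/ffunP => p; rewrite -(gor_dualK p) -!gor_socle_basis; exact: h.
Qed.

End Gor.

(** * Extension of functionals and self-injectivity *)

Section Extension.
Variables (U V : zmodType) (i : U -> V) (g : U -> bool).
Hypothesis V_two : forall v : V, v + v = 0.
Hypothesis iD : forall x y, i (x + y) = i x + i y.
Hypothesis i_inj : injective i.
Hypothesis gD : forall x y, g (x + y) = g x (+) g y.

(* A subgroup of V containing i (Ker g) and maximal for avoiding i u, where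
   g u = 1, has index 2. *)
Lemma extend_functional :
  exists h : V -> bool, (forall x y, h (x + y) = h x (+) h y) /\
                        forall u, h (i u) = g u.
Proof.
have V2 (v w : V) : v + w + w = v by rewrite -addrA V_two addr0.
have U2 (u : U) : u + u = 0.
  by apply: i_inj; rewrite iD V_two; apply: (addrI (i 0)); rewrite -iD !addr0.
have [[u0 gu0]|g0] := pselect (exists u, g u); last first.
  exists (fun=> false); split=> // u; apply/esym/negbTE/negP => gu.
  by apply: g0; exists u.
(* The second clause is conditional on W being inhabited, so that the union of the empty chain
   satisfies [P]. *)
pose P (W : set V) :=
  [/\ forall x y, W x -> W y -> W (x + y),
      forall w, W w -> forall u, g u = false -> W (i u) & ~ W (i u0)].
have Pker : P (fun v => exists2 u, g u = false & v = i u).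
  split=> [_ _ [u gu ->] [u' gu' ->]|_ _ u gu|[u gu /i_inj e]].
  - by exists (u + u'); rewrite ?iD // gD gu gu'.
  - by exists u.
  - by rewrite e gu in gu0.
have [W [PW Wmax]] : exists W, P W /\ forall B, W `<` B -> ~ P B.
  apply: Zorn_bigcup => F FP Ftot; split.
  - move=> x y [B FB Bx] [C FC Cy].
    have [BC|CB] := Ftot _ _ FB FC.
      by exists C => //; have [CD _ _] := FP _ FC; apply: CD => //; apply: BC.
    by exists B => //; have [BD _ _] := FP _ FB; apply: BD => //; apply: CB.
  - move=> w [B FB Bw] u gu; exists B => //.
    by have [_ /(_ w Bw u gu) ] := FP _ FB.
  - by move=> [B FB Bu]; have [_ _] := FP _ FB; apply.
have [WD WK Wu0] := PW.
have [w0 Ww0] : exists w, W w.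
  apply: contrapT => W0; apply: (Wmax _ _ Pker); split.
    by move=> x Wx; case: W0; exists x.
  have g_0 : g 0 = false by have := gD 0 0; rewrite addr0; case: (g 0).
  by move=> h; apply: W0; exists (i 0); apply: h; exists 0.
have {WK} WK u : g u = false -> W (i u) by apply: WK Ww0 u.
have W0 : W 0 by rewrite -(V_two w0); apply: WD.
(* By maximality the union of W and v + W must contain [i u0]. *)
have Wcompl v : ~ W v -> exists2 w, W w & v = i u0 + w.
  move=> nWv; apply: contrapT => nex.
  pose B x := W x \/ exists2 w, W w & x = v + w.
  apply: (Wmax B); split.
  - by move=> x Wx; left.
  - by move=> /(_ v) h; apply: nWv; apply: h; right; exists 0; rewrite ?addr0.
  - move=> x y [Wx|[w Ww ->]] [Wy|[w' Ww' ->]].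
    + by left; apply: WD.
    + by right; exists (x + w'); [apply: WD|rewrite addrCA].
    + by right; exists (w + y); [apply: WD|rewrite addrA].
    + left; rewrite addrACA V_two add0r; exact: WD.
  - by move=> x _ u gu; left; apply: WK.
  - move=> [//|[w Ww e]]; apply: nex; exists w => //.
    by rewrite e V2.
exists (fun v => ~~ `[< W v >]); split=> [x y|u].
  have E a b : W a -> ~ W b -> ~ W (a + b).
    by move=> Wa Wb Wab; apply: Wb; rewrite -(V2 b a) [b + a]addrC; apply: WD.
  case: (asboolP (W x)) => Wx; case: (asboolP (W y)) => Wy /=.
  - by rewrite asboolT //; apply: WD.
  - by rewrite asboolF //; apply: E.
  - by rewrite asboolF // addrC; apply: E.
  - rewrite asboolT //; have [w Ww ->] := Wcompl _ Wx; have [w' Ww' ->] := Wcompl _ Wy.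
    by rewrite addrACA V_two add0r; apply: WD.
case gu: (g u); last by rewrite asboolT //; apply: WK.
rewrite asboolF // => Wu; apply: Wu0.
have -> : u0 = u + (u0 + u) by rewrite addrCA U2 addr0.
by rewrite iD; apply: WD => //; apply: WK; rewrite gD gu gu0.
Qed.

End Extension.

(** The socle coordinate of f extends to a functional h on V. Nondegeneracy of the socle form gives
    a unique g v with tau (s * g v) = h (s *: v) for all s, and uniqueness makes g linear and an
    extension of f. *)
Lemma gor_injective n e : injective_module (gor bool n e)^o.
Proof.
move=> U V i f inj_i; set S := gor bool n e.
have V_two (v : V) : v + v = 0.
  by rewrite -[v]scale1r -scalerDl gor_two scale0r.
pose tau (s : S) := s ps.
have tauD s t : tau (s + t) = tau s (+) tau t by rewrite /tau ffunE.
have [h [hD hi]] := @extend_functional U V i (fun u => tau (f u)) V_two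
  (fun x y => linearD i x y) inj_i (fun x y => etrans (congr1 tau (linearD f x y)) (tauD _ _)).
have h0 : h 0 = false by have := hD 0 0; rewrite addr0; case: (h 0).
pose g (v : V) : S := [ffun p => h (gor_basis (gor_dual p) *: v)].
have gE s v : tau (s * g v) = h (s *: v).
  rewrite [s]gor_sum_basis mulr_suml scaler_suml /tau sum_ffunE.
  rewrite (big_morph h hD h0); apply: eq_bigr => p _.
  by rewrite gor_socle_basis ffunE gor_dualK.
have g_lin : linear (g : V -> S^o).
  move=> r x y; apply: gor_eqP => s.
  have -> : s * (r *: (g x : S^o) + g y) = (s * r) * g x + s * g y.
    by rewrite mulrDr mulrA.
  by rewrite -[LHS]/(tau _) -[RHS]/(tau _) tauD !gE scalerDr scalerA hD.
pose gl : {linear V -> S^o} := HB.pack (g : V -> S^o)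
  (GRing.isLinear.Build S V S^o *:%R (g : V -> S^o) g_lin).
exists gl => u; apply: gor_eqP => s; rewrite -[LHS]/(tau (s * g (i u))) gE.
by rewrite -linearZ hi /tau linearZ.
Qed.

(** * The maximal ideal and the length *)

Section Gor2.
Variables n e : nat.
Local Notation T := (gor bool n e).
Implicit Types (x y z s t : T) (p q : pos n e).

Definition gor_max : set T := [set x | x pu = false].

Lemma gor_max_ideal : is_ideal gor_max.
Proof.
split=> [|x y|r x]; rewrite /gor_max /=.
- by rewrite ffunE.
- by rewrite ffunE => -> ->.
- by rewrite gor_unit => ->; rewrite mulr0.
Qed.

Lemma gor1E p : (1 : T) p = (p == pu).
Proof. by rewrite ffunE; case: (p == _). Qed.

Lemma gor_opp x : - x = x.
Proof. by apply: (addrI x); rewrite subrr gor_two. Qed.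

(** The square of an element of m lies in V^* plus the socle, and any two elements of that subspace
    have product 0. *)
Lemma gor_max_nilp x : gor_max x -> (x * x) * (x * x) = 0.
Proof.
move=> x0; have xx k : (x * x) (pv k) = 0.
  by rewrite gor_mulE ffunE x0 !mul0r addr0.
have xw k : (x * x) (pw k) = 0 by rewrite gor_mulE ffunE x0 !mul0r addr0.
have xu : (x * x) pu = 0 by rewrite gor_unit x0 mul0r.
apply/ffunP => p; rewrite gor_mulE ffunE [RHS]ffunE.
have c0 k : cub (x * x) (x * x) k = 0.
  by rewrite /cub big1 // => i _; rewrite big1 // => j _; rewrite xx mul0r mulr0.
have d0 : dotvd (x * x) (x * x) = 0.
  by rewrite /dotvd big1 // => i _; rewrite xx mul0r.
have w0 : dotww (x * x) (x * x) = 0.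
  by rewrite /dotww big1 // => i _; rewrite xw mul0r.
by case: p => [i|i|j||]; rewrite ?c0 ?d0 ?w0 xu !mul0r ?addr0.
Qed.

Lemma gor_proper_ideal I : is_ideal I -> ~ I (1 : T) -> I `<=` gor_max.
Proof.
move=> [I0 ID IM] I1 x Ix; rewrite /gor_max /=; apply/negbTE/negP => xu.
have y0 : gor_max (1 + x) by rewrite /gor_max /= ffunE gor1E xu.
(* Since x = 1 + y with y^4 = 0, the inverse of x is 1 + y + y^2 + y^3. *)
apply: I1; pose y := 1 + x.
have e1 : (1 + y) * (1 + y + y * y + y * y * y)
  = 1 + y * y * (y * y) + (y + y * y + y * y * y + (y + y * y + y * y * y)).
  by ring.
rewrite (gor_max_nilp y0) gor_two !addr0 in e1.
rewrite -e1 mulrC; apply: IM; rewrite /y addrA gor_two add0r; exact: Ix.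
Qed.

Lemma gor_local : is_local gor_max.
Proof.
have max_gt I : is_ideal I -> ~ I 1 -> gor_max `<=` I -> I = gor_max.
  by move=> hI I1 mI; apply/seteqP; split=> //; apply: gor_proper_ideal.
have m1 : ~ gor_max 1 by rewrite /gor_max /= gor1E.
split; first by split=> //; exact: gor_max_ideal.
move=> I [hI I1 Imax]; apply/esym/Imax => //; first exact: gor_max_ideal.
exact: gor_proper_ideal.
Qed.

Lemma gor_artinian_gorenstein : artinian_gorenstein_local gor_max.
Proof.
pose s : seq T := enum {ffun pos n e -> bool}.
have hs x : x \in s by rewrite mem_enum.
split; [exact: finite_noetherian hs|exact: gor_local|exact: finite_artinian hs|].
exists 0%N; exact: gor_injective.
Qed.

(** Orders the basis from the socle up to the unit. Multiples of a basis element involve only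
    elements of no larger rank, so initial segments span ideals. *)
Definition rank p : nat := match p with
  | ps => 0 | pd i => 1 + i | pw j => 1 + n + j | pv i => 1 + n + e + i
  | pu => 1 + n + e + n end%N.

Lemma rank_inj : injective rank.
Proof.
by move=> [[i hi]|[i hi]|[i hi]||] [[j hj]|[j hj]|[j hj]||] //= h;
  try (congr pv || congr pd || congr pw; apply: val_inj => /=); lia.
Qed.

Lemma rank_lt p : (rank p < 2 * n + e + 2)%N.
Proof. by case: p => [[i hi]|[i hi]|[i hi]||] /=; lia. Qed.

Lemma rank_surj j : (j < 2 * n + e + 2)%N -> exists p, rank p = j.
Proof.
move=> hj; have [j0|j0] := posnP j; first by exists ps.
have [h1|h1] := ltnP (j - 1) n; first by exists (pd (Ordinal h1)); rewrite /=; lia.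
have [h2|h2] := ltnP (j - 1 - n) e; first by exists (pw (Ordinal h2)); rewrite /=; lia.
have [h3|h3] := ltnP (j - 1 - n - e) n.
  by exists (pv (Ordinal h3)); rewrite /=; lia.
by exists pu; rewrite /=; lia.
Qed.

Definition rank_ideal j : set T := [set x | forall p, (j <= rank p)%N -> x p = false].

Lemma rank_idealP j : is_ideal (rank_ideal j).
Proof.
split=> [p _|x y hx hy p jp|r x hx p jp]; first by rewrite ffunE.
  by rewrite ffunE hx // hy.
rewrite gor_mulE ffunE.
have xu : x pu = 0.
  apply: hx; apply: leq_trans jp _.
  by case: p => [[i hi]|[i hi]|[i hi]||] /=; lia.
case: p jp => [i|i|k||] /= jp.
- by rewrite xu hx // mulr0 mul0r addr0.
- rewrite xu hx // mulr0 mul0r !add0r /cub big1 // => k _; rewrite big1 // => l _.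
  by rewrite (hx (pv l)) ?mulr0 //=; have := ltn_ord i; lia.
- by rewrite xu hx // mulr0 mul0r addr0.
- by rewrite xu mulr0.
- have x0 p : x p = 0 by apply: hx; lia.
  rewrite !x0 mulr0 mul0r !add0r /dotvd /dotww !big1 ?addr0 // => k _;
    by rewrite x0 ?mulr0 ?mul0r.
Qed.

Lemma gor_length : has_length T (2 * n + e + 2).
Proof.
exists rank_ideal; split.
- apply/seteqP; split=> x /=; last by move=> -> p _; rewrite ffunE.
  by move=> hx; apply/ffunP => p; rewrite hx // ffunE.
- by apply/seteqP; split=> // x _ p; rewrite leqNgt rank_lt.
- exact: rank_idealP.
move=> j hj; have [p pj] := rank_surj hj.
have bp : rank_ideal j.+1 (gor_basis p).
  by move=> q jq; rewrite gor_basisE; case: eqP => // qp; move: jq; rewrite qp pj ltnn.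
(* Over F_2 the coordinate at p is cleared by adding [gor_basis p] or nothing. *)
have split_j x : rank_ideal j.+1 x -> rank_ideal j x \/ rank_ideal j (x + gor_basis p).
  move=> hx; case xp: (x p); [right|left]=> q jq; rewrite ?ffunE ?gor_basisE.
    case: eqP => [->|qp]; first by rewrite xp.
    rewrite addr0; apply: hx; rewrite ltn_neqAle jq andbT -pj.
    by apply/eqP => /rank_inj/esym.
  have [->//|qp] := eqVneq q p; apply: hx; rewrite ltn_neqAle jq andbT -pj.
  by rewrite eq_sym (inj_eq rank_inj).
have sub : rank_ideal j `<=` rank_ideal j.+1.
  by move=> x hx q jq; apply: hx; apply: ltnW.
split=> //.
  move=> h; have : rank_ideal j (gor_basis p) by rewrite h.
  by move=> /(_ p); rewrite pj leqnn gor_basisE eqxx => /(_ isT).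
move=> J [J0 JD JM] jJ Jj.
have [Jsub|] := pselect (J `<=` rank_ideal j).
  by left; apply/seteqP.
move=> /existsNP[x /not_implyP[Jx nx]]; right; apply/seteqP; split=> // y hy.
have [//|xb] := split_j x (Jj _ Jx).
have Jb : J (gor_basis p).
  have -> : gor_basis p = x + (x + gor_basis p) by rewrite addrA gor_two add0r.
  by apply: JD => //; apply: jJ.
have [/jJ//|/jJ Jy] := split_j y hy.
have -> : y = (y + gor_basis p) + gor_basis p by rewrite -addrA gor_two addr0.
exact: JD.
Qed.

End Gor2.

(** * Powers of the maximal ideal and the h-vector *)

Section IdealMul.
Variables (R : comNzRingType) (I J : set R).

Lemma ideal_mul_mem x y : I x -> J y -> ideal_mul I J (x * y).
Proof.
by move=> Ix Jy; exists 1%N, (fun=> x), (fun=> y); split=> //; rewrite big_ord1.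
Qed.

Lemma ideal_mul0 : ideal_mul I J 0.
Proof.
by exists 0%N, (fun=> 0), (fun=> 0); rewrite big_ord0; split=> // -[].
Qed.

Lemma ideal_mulD x y : ideal_mul I J x -> ideal_mul I J y -> ideal_mul I J (x + y).
Proof.
move=> [p [a [b [hab ->]]]] [q [c [d [hcd ->]]]].
exists (p + q)%N, (fun i => match split i with inl j => a j | inr j => c j end).
exists (fun i => match split i with inl j => b j | inr j => d j end); split.
  by move=> i; case: (split i).
rewrite big_split_ord /=; congr (_ + _); apply: eq_bigr => i _.
  by rewrite (unsplitK (inl i)).
by rewrite (unsplitK (inr i)).
Qed.

Lemma ideal_mul_sub (K : set R) : is_ideal K ->
  (forall x y, I x -> J y -> K (x * y)) -> ideal_mul I J `<=` K.
Proof.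
move=> [K0 KD _] h _ [p [a [b [hab ->]]]]; apply: (big_ind K) => // i _.
by have [? ?] := hab i; apply: h.
Qed.

End IdealMul.

(** The k-th dual vector is a product of two basis vectors of V: the other two factors of a monomial
    containing X_k, or X_k twice when k is at least 8. Hence V^* lies in m^2. *)
Lemma cubic_dual (n k : nat) : (8 <= n)%N -> (k < n)%N ->
  exists i j, [/\ (i < n)%N, (j < n)%N & forall l, cubic i j l = (l == k)].
Proof.
move=> n8; have E i j : (i < 8)%N -> (j < 8)%N ->
    (forall l, cubic i j l = (l == k)) ->
    exists i j, [/\ (i < n)%N, (j < n)%N & forall l, cubic i j l = (l == k)].
  by move=> i8 j8 h; exists i, j; split=> //; lia.
case: k E => [|[|[|[|[|[|[|[|k]]]]]]]] E kn.
- by apply: (E 2 4)%N => // -[|[|[|[|[|[|[|[|l]]]]]]]].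
- by apply: (E 2 6)%N => // -[|[|[|[|[|[|[|[|l]]]]]]]].
- by apply: (E 0 4)%N => // -[|[|[|[|[|[|[|[|l]]]]]]]].
- by apply: (E 0 5)%N => // -[|[|[|[|[|[|[|[|l]]]]]]]].
- by apply: (E 0 2)%N => // -[|[|[|[|[|[|[|[|l]]]]]]]].
- by apply: (E 0 3)%N => // -[|[|[|[|[|[|[|[|l]]]]]]]].
- by apply: (E 1 2)%N => // -[|[|[|[|[|[|[|[|l]]]]]]]].
- by apply: (E 1 3)%N => // -[|[|[|[|[|[|[|[|l]]]]]]]].
exists (8 + k)%N, (8 + k)%N; split=> // l.
by rewrite /cubic /triple /= eqxx eq_sym.
Qed.

Section Products.
Variables n e : nat.
Local Notation T := (gor bool n e).

Lemma cub_basis (i j k : 'I_n) :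
  cub (gor_basis (pv i) : T) (gor_basis (pv j)) k = cubic i j k.
Proof.
rewrite /cub (sum_pick (i := i) (G := fun i => cubic i j k)) // => i'.
rewrite (sum_pick (i := j) (G := fun j => (i' == i) && cubic i' j k)) // => j'.
have E (a b : 'I_n) : (gor_basis (pv b) : T) (pv a) = (a == b) by rewrite gor_basisE.
by rewrite (E i') (E j'); case: (cubic _ _ _); case: (i' == i); case: (j' == j).
Qed.

Lemma gor_basis_mulvv (i j : 'I_n) (p : pos n e) :
  (gor_basis (pv i) * gor_basis (pv j) : T) p = if p is pd k then cubic i j k else false.
Proof.
case: p => [k|k|k||]; rewrite gor_mul_coord ?dotvd_basisl ?dotww_basis.
- by rewrite !gor_basisE.
- by rewrite cub_basis !gor_basisE.
- by rewrite !gor_basisE.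
- by rewrite !gor_basisE.
- by rewrite !gor_basisE.
Qed.

Lemma gor_basis_mulvd (i : 'I_n) :
  gor_basis (pv i) * gor_basis (pd i) = gor_basis ps :> T.
Proof.
have c0 k : cub (gor_basis (pv i) : T) (gor_basis (pd i)) k = 0.
  rewrite /cub big1 // => a _; rewrite big1 // => b _.
  by rewrite [gor_basis (pd i) _]gor_basisE !mulr0.
apply/ffunP => p; rewrite gor_basisE.
case: p => [k|k|k||]; rewrite gor_mul_coord ?dotvd_basisl ?dotww_basis.
- by rewrite !gor_basisE.
- by rewrite c0 !gor_basisE.
- by rewrite !gor_basisE.
- by rewrite !gor_basisE.
- by rewrite !gor_basisE /= eqxx.
Qed.

Lemma rank_ideal_sub j (K : set T) : K 0 -> (forall x y, K x -> K y -> K (x + y)) ->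
  (forall p, (rank p < j)%N -> K (gor_basis p)) -> rank_ideal j `<=` K.
Proof.
move=> K0 KD Kb x hx; rewrite (gor_sum_basis x); apply: (big_ind K) => // p xp.
by apply: Kb; rewrite ltnNge; apply/negP => /hx; rewrite xp.
Qed.

(** As the residue field is F_2, coefficients 0 and 1 suffice to span. The coordinate at [b l] of a
    relation isolates its l-th coefficient modulo m. *)
Lemma has_dim_coord (M B : set T) d (b : 'I_d -> pos n e) :
  injective b -> (forall l, M (gor_basis (b l))) ->
  (forall x, M x -> B (x + \sum_(l | x (b l)) gor_basis (b l))) ->
  (forall x l, B x -> x (b l) = false) ->
  (forall (r : T) k l, (r * gor_basis (b k)) (b l) = r pu && (l == k)) ->
  @has_dim_mod T T^o (@gor_max n e) M B d.
Proof.
move=> b_inj Mb MB Bb hb; exists (fun l => gor_basis (b l)).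
split=> // [x Mx|s r us _ Bs l ls].
  exists [seq l <- index_enum 'I_d | x (b l)], (fun=> 1); split.
    by apply/allP.
  rewrite big_filter; under eq_bigr => l _ do rewrite scale1r.
  by rewrite (gor_opp (\sum_(l | _) gor_basis (b l) : T)); apply: MB.
have := Bb _ l Bs; rewrite /gor_max /=.
rewrite sum_ffunE (bigD1_seq l) //= big1 ?addr0 => [|k kl].
  by rewrite hb eqxx andbT.
by rewrite hb eq_sym (negbTE kl) andbF.
Qed.

End Products.

Section HVector.
Variable n : nat.
Hypothesis n8 : (8 <= n)%N.
Local Notation T := (gor bool n 0).
Local Notation m := (@gor_max n 0).

(** The lengths of S, m, m^2 and m^3; the default 0 of [nth] covers the higher powers, which
    vanish. *)
Let hrank i : nat := nth 0%N [:: 2 * n + 2; 1 + n + n; 1 + n; 1]%N i.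
Let o : 'I_n := Ordinal (leq_trans (isT : (0 < 8)%N) n8).

Lemma gor_max_exp i : ideal_exp m i = rank_ideal (hrank i).
Proof.
have m_basis k : m (gor_basis (pv k)) by rewrite /gor_max /= gor_basisE.
have ideal_rank a b : rank_ideal b `<=` ideal_mul m (rank_ideal a) ->
    (forall (x y : T), m x -> rank_ideal a y -> rank_ideal b (x * y)) ->
    ideal_mul m (rank_ideal a) = rank_ideal b.
  move=> h1 h2; apply/seteqP; split=> //; apply: ideal_mul_sub h2.
  exact: rank_idealP.
elim: i => [|i IH] /=.
  apply/seteqP; split=> // x _ p; rewrite leqNgt.
  by have := rank_lt p; rewrite addn0 /hrank /= => ->.
rewrite IH; apply: ideal_rank.
  apply: rank_ideal_sub; [exact: ideal_mul0|exact: ideal_mulD|].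
  move=> p; rewrite /hrank; case: i {IH} => [|[|[|i]]] //=; last by case: i.
  - move=> pn; rewrite -[gor_basis p]mulr1; apply: ideal_mul_mem.
      by rewrite /gor_max /= gor_basisE; case: p pn => //=; lia.
    by move=> q; rewrite leqNgt; have := rank_lt q; rewrite addn0 => ->.
  - case: p => [k|k|[]||] //=; [lia| |lia|] => _.
      have [i [j [hi hj hij]]] := cubic_dual n8 (ltn_ord k).
      have -> : gor_basis (pd k)
          = gor_basis (pv (Ordinal hi)) * gor_basis (pv (Ordinal hj)) :> T.
        apply/ffunP => p; rewrite gor_basis_mulvv gor_basisE.
        by case: p => [l|l|[]||] //; rewrite hij.
      apply: ideal_mul_mem => // q; rewrite gor_basisE; case: eqP => // -> /=.
      have := ltn_ord (Ordinal hj); lia.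
    (* The socle is spanned by the product of any basis vector of V with its dual; [o] is an
       arbitrary choice. *)
    rewrite -(gor_basis_mulvd _ o); apply: ideal_mul_mem => // q.
    by rewrite gor_basisE; case: eqP => // -> /=; lia.
  - case: p => [k|k|[]||] //= _.
    rewrite -(gor_basis_mulvd _ o); apply: ideal_mul_mem => // q.
    rewrite gor_basisE; case: eqP => // -> /=; lia.
(* The reverse inclusion, coordinate by coordinate: x has no unit part, and which parts of y vanish
   depends on i. *)
move=> x y mx hy p hp; have {mx} xu : x pu = false := mx.
have yu : (0 < i)%N -> y pu = false.
  case: i hy {IH hp} => // i hy _; apply: hy; rewrite /hrank.
  by case: i => [|[|[|[|i]]]] /=; lia.
have yv k : (1 < i)%N -> y (pv k) = false.
  case: i hy {IH hp yu} => // i hy hi; apply: hy; rewrite /hrank.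
  by case: i hi => [|[|[|[|i]]]] /=; lia.
have yd k : (2 < i)%N -> y (pd k) = false.
  case: i hy {IH hp yu yv} => // i hy hi; apply: hy; rewrite /hrank.
  by case: i hi => [|[|[|[|i]]]] /=; lia.
case: p hp => [k|k|[]||] hp //; rewrite gor_mul_coord xu ?andbF //=.
- rewrite yu //; move: hp; rewrite /hrank.
  case: i {IH hy yu yv yd} => //=; have := ltn_ord k; lia.
- have i2 : (1 < i)%N.
    move: hp; rewrite /hrank.
    by case: i {IH hy yu yv yd} => [|[|i]] //=; have := ltn_ord k; lia.
  rewrite yu ?(ltnW i2) //= /cub big1 // => a _; rewrite big1 // => b _.
  by rewrite yv ?mulr0.
- have i3 : (2 < i)%N by move: hp; rewrite /hrank; case: i {IH hy yu yv yd} => [|[|[|i]]].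
  rewrite yu ?(ltn_trans _ i3) //= /dotvd /dotww big_ord0.
  rewrite !big1 // => k _; first by rewrite yv ?mul0r // (ltn_trans _ i3).
  by rewrite yd ?mulr0.
Qed.

Lemma gor_hvector : has_hvector m [:: 1; n; n; 1]%N.
Proof.
split=> // i; rewrite !gor_max_exp.
have sum_split (j k : nat) d (b : 'I_d -> pos n 0) (x : T) : injective b ->
    (forall p, (k <= rank p < j)%N -> exists l, b l = p) ->
    rank_ideal j x -> rank_ideal k (x + \sum_(l | x (b l)) gor_basis (b l)).
  move=> b_inj hb hx p kp; rewrite ffunE sum_ffunE.
  have [jp|pj] := leqP j (rank p).
    rewrite hx // big1 // => l xl; rewrite gor_basisE; apply/negbTE/eqP => pl.
    by move: xl; rewrite -pl hx.
  have [l bl] : exists l, b l = p by apply: hb; rewrite kp.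
  rewrite big_mkcond (bigD1 l) //= big1 => [|l' ll']; last first.
    by rewrite gor_basisE -bl (inj_eq b_inj) eq_sym (negbTE ll') if_same.
  by rewrite bl gor_basisE eqxx; case: (x p).
have coord (j k : nat) d (b : 'I_d -> pos n 0) : injective b ->
    (forall l, (k <= rank (b l) < j)%N) ->
    (forall p, (k <= rank p < j)%N -> exists l, b l = p) ->
    (forall (r : T) k l, (r * gor_basis (b k)) (b l) = r pu && (l == k)) ->
    @has_dim_mod T T^o m (rank_ideal j) (rank_ideal k) d.
  move=> b_inj bjk hb hr; apply: (has_dim_coord b_inj) => //.
  - move=> l p jp; rewrite gor_basisE; apply/negbTE/eqP => e.
    by have := bjk l; rewrite -e; lia.
  - by move=> x; apply: sum_split.
  - by move=> x l; apply; case/andP: (bjk l).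
case: i => [|[|[|[|i]]]]; rewrite /hrank /=.
- apply: (coord _ _ _ (fun=> pu)); first by move=> a b; rewrite !ord1.
  + by move=> l /=; lia.
  + by move=> [k|k|[]//||] /= hp; try (exists ord0 => //); have := ltn_ord k; lia.
  + by move=> r a b; rewrite gor_mul_coord gor_basisE !ord1.
- apply: (coord _ _ _ (fun l => pv l)); first by move=> a b [].
  + by move=> l /=; have := ltn_ord l; lia.
  + by move=> [k|k|[]//||] /= hp; [exists k|have := ltn_ord k; lia|lia|lia].
  + by move=> r a b; rewrite gor_mul_coord !gor_basisE addbF.
- apply: (coord _ _ _ (fun l => pd l)); first by move=> a b [].
  + by move=> l /=; have := ltn_ord l; lia.
  + by move=> [k|k|[]//||] /= hp; [lia|exists k|lia|lia].
  + move=> r a b; rewrite gor_mul_coord !gor_basisE /cub big1 ?addbF // => k _.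
    by rewrite big1 // => l _; rewrite gor_basisE !mulr0.
- apply: (coord _ _ _ (fun=> ps)); first by move=> a b; rewrite !ord1.
  + by move=> l /=; lia.
  + by move=> [k|k|[]//||] /= hp; [lia|lia|lia|exists ord0].
  + move=> r a b; rewrite gor_mul_coord dotvd_basisl dotvd_basisr dotww_C dotww_basis.
    by rewrite !gor_basisE !ord1 /= !addbF.
- rewrite !nth_nil; apply: (coord _ _ _ (fun l : 'I_0 => ps)).
  + by case.
  + by case.
  + by move=> p /andP[].
  + by move=> r [].
Qed.

End HVector.

(** * The residue map onto k[X, Z]/((X)^2 + (Z)^2) *)

Lemma mul_span_eq0 (R : comNzRingType) (A : bool -> R) (a b c d : R) :
  (forall u v, A u * A v = 0) ->
  (a * A true + b * A false) * (c * A true + d * A false) = 0.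
Proof.
move=> hA.
have -> : (a * A true + b * A false) * (c * A true + d * A false)
  = a * c * (A true * A true) + (a * d + b * c) * (A true * A false)
    + b * d * (A false * A false) by ring.
by rewrite !hA !mulr0 !addr0.
Qed.

(* The multiplication of k[X, Z]/((X)^2 + (Z)^2), with x, x' linear in X,
   z, z' linear in Z and q, q' spanned by the products X Z. *)
Lemma mul_square_zero (R : comNzRingType) (a a' x x' z z' q q' : R) :
  x * x' = 0 -> x * q' = 0 -> x' * q = 0 -> q * q' = 0 -> z * z' = 0 ->
  z * q' = 0 -> z' * q = 0 ->
  (a + x + z + q) * (a' + x' + z' + q')
  = a * a' + (a * x' + a' * x) + (a * z' + a' * z)
    + (a * q' + a' * q + (x * z' + x' * z)).
Proof.
move=> h1 h2 h3 h4 h5 h6 h7.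
have -> : (a + x + z + q) * (a' + x' + z' + q')
  = a * a' + (a * x' + a' * x) + (a * z' + a' * z)
    + (a * q' + a' * q + (x * z' + x' * z))
    + (x * x' + x * q' + x' * q + q * q' + z * z' + z * q' + z' * q) by ring.
by rewrite h1 h2 h3 h4 h5 h6 h7 !addr0.
Qed.

(** Let x_1, x_2, z_1, z_2 be X_0, X_1, X_2, X_3. This and the next three lemmas show that the
    coordinates dual to X_4, ..., X_7 of a product in V come only from x_1 z_1, x_1 z_2, x_2 z_1,
    x_2 z_2. *)
Lemma cubic4 i j : cubic i j 4
  = (i == 0) && (j == 2) || (i == 2) && (j == 0).
Proof.
by case: i => [|[|[|[|[|[|[|[|i]]]]]]]]; case: j => [|[|[|[|[|[|[|[|j]]]]]]]];
  rewrite /cubic /triple /= ?andbF.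
Qed.

Lemma cubic5 i j : cubic i j 5
  = (i == 0) && (j == 3) || (i == 3) && (j == 0).
Proof.
by case: i => [|[|[|[|[|[|[|[|i]]]]]]]]; case: j => [|[|[|[|[|[|[|[|j]]]]]]]];
  rewrite /cubic /triple /= ?andbF.
Qed.

Lemma cubic6 i j : cubic i j 6
  = (i == 1) && (j == 2) || (i == 2) && (j == 1).
Proof.
by case: i => [|[|[|[|[|[|[|[|i]]]]]]]]; case: j => [|[|[|[|[|[|[|[|j]]]]]]]];
  rewrite /cubic /triple /= ?andbF.
Qed.

Lemma cubic7 i j : cubic i j 7
  = (i == 1) && (j == 3) || (i == 3) && (j == 1).
Proof.
by case: i => [|[|[|[|[|[|[|[|i]]]]]]]]; case: j => [|[|[|[|[|[|[|[|j]]]]]]]];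
  rewrite /cubic /triple /= ?andbF.
Qed.

Section Residue.
Variables n e : nat.
Hypothesis n8 : (8 <= n)%N.
Local Notation T := (gor bool n e).
Variable D : tate_model.
Variables varX varZ : bool -> D.
Hypothesis varXX : forall u v, varX u * varX v = 0.
Hypothesis varZZ : forall u v, varZ u * varZ v = 0.

Definition ix k (hk : (k < 8)%N) : 'I_n := Ordinal (leq_trans hk n8).
Local Notation "''v_' k" := (pv (@ix k isT)) (at level 8, k at level 2).
Local Notation "''d_' k" := (pd (@ix k isT)) (at level 8, k at level 2).

Definition linX (s : T) : D :=
  (s 'v_0)%:R * varX true + (s 'v_1)%:R * varX false.
Definition linZ (s : T) : D :=
  (s 'v_2)%:R * varZ true + (s 'v_3)%:R * varZ false.
Definition quadXZ (s : T) : D :=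
  ((s 'd_4)%:R * varZ true + (s 'd_5)%:R * varZ false) * varX true
  + ((s 'd_6)%:R * varZ true + (s 'd_7)%:R * varZ false) * varX false.
(** The quotient map S -> T followed by the map from T to [D] given by [varX] and [varZ];
    coordinates other than those of 1, x_i, z_j and x_i z_j are dropped. *)
Definition residue (s : T) : D := (s pu)%:R + linX s + linZ s + quadXZ s.

Let qD (b c : bool) : (b (+) c)%:R = b%:R + c%:R :> D.
Proof. exact: mulrn_addb (@tm_two D) b c. Qed.
Let qM (b c : bool) : (b && c)%:R = b%:R * c%:R :> D.
Proof. by case: b; case: c; rewrite /= ?mul1r ?mul0r. Qed.

Lemma residueD s t : residue (s + t) = residue s + residue t.
Proof.
rewrite /residue /linX /linZ /quadXZ.
have E p : (s + t) p = s p (+) t p by rewrite ffunE.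
by rewrite !E !qD; ring.
Qed.

Lemma residue1 : residue 1 = 1.
Proof.
have Ev i : (1 : T) (pv i) = false by rewrite gor1E.
have Ed i : (1 : T) (pd i) = false by rewrite gor1E.
rewrite /residue /linX /linZ /quadXZ !Ev !Ed gor1E eqxx mulr0n mulr1n.
by rewrite !mul0r !addr0 !mul0r !addr0.
Qed.

Lemma cub_pick (s t : T) (p q k : 'I_n) : p != q ->
  (forall i j, cubic i j k = (i == p) && (j == q) || (i == q) && (j == p)) ->
  cub s t k = s (pv p) && t (pv q) (+) s (pv q) && t (pv p).
Proof.
move=> pq hc; rewrite /cub.
have E (a b : 'I_n) : \sum_(i < n) \sum_(j < n)
    ((i == a) && (j == b))%:R * (s (pv i) * t (pv j)) = s (pv a) && t (pv b).
  rewrite (sum_pick (i := a) (G := fun i => s (pv i) && t (pv b))) // => i.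
  rewrite (sum_pick (i := b) (G := fun j => (i == a) && (s (pv i) && t (pv j)))) // => j.
  by case: (i == a); case: (j == b).
rewrite -!E -big_split; apply: eq_bigr => i _; rewrite -big_split.
apply: eq_bigr => j _ /=; rewrite hc !val_eqE.
have [->|ip] := eqVneq i p; last first.
  by case: (i == q); case: (j == p); case: (s _); case: (t _).
by rewrite (negbTE pq); case: (j == q); case: (s _); case: (t _).
Qed.

Lemma residueM s t : residue (s * t) = residue s * residue t.
Proof.
have cubP (p q k : 'I_n) : p != q -> (forall i j : nat, cubic i j k =
    (i == p) && (j == q) || (i == q) && (j == p)) ->
    (cub s t k)%:R = (s (pv p))%:R * (t (pv q))%:R + (s (pv q))%:R * (t (pv p))%:R :> D.
  by move=> pq hc; rewrite (cub_pick _ _ pq hc) qD !qM.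
have c4 := cubP (@ix 0 isT) (@ix 2 isT) (@ix 4 isT) isT.
have c5 := cubP (@ix 0 isT) (@ix 3 isT) (@ix 5 isT) isT.
have c6 := cubP (@ix 1 isT) (@ix 2 isT) (@ix 6 isT) isT.
have c7 := cubP (@ix 1 isT) (@ix 3 isT) (@ix 7 isT) isT.
have {}c4 := c4 (fun i j => cubic4 i j).
have {}c5 := c5 (fun i j => cubic5 i j).
have {}c6 := c6 (fun i j => cubic6 i j).
have {}c7 := c7 (fun i j => cubic7 i j).
(* Regrouped by the variables Z, to see that products of [linZ] and [quadXZ] vanish. *)
have qE x : quadXZ x = ((x 'd_4)%:R * varX true + (x 'd_6)%:R * varX false) * varZ true
    + ((x 'd_5)%:R * varX true + (x 'd_7)%:R * varX false) * varZ false.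
  by rewrite /quadXZ; ring.
rewrite [RHS]mul_square_zero.
- rewrite /residue /linX /linZ /quadXZ !gor_mul_coord.
  rewrite !qD c4 c5 c6 c7 !qM; ring.
- exact: mul_span_eq0.
- exact: mul_span_eq0.
- exact: mul_span_eq0.
- exact: mul_span_eq0.
- exact: mul_span_eq0.
- by rewrite qE; apply: mul_span_eq0.
- by rewrite qE; apply: mul_span_eq0.
Qed.

Lemma residue_fil (s : T) : (forall u, tm_fil 1 (varX u)) ->
  (forall u, tm_fil 1 (varZ u)) ->
  tm_fil 1 (residue s).
Proof.
move=> fX fZ.
have fq (b : bool) : tm_fil 1 (b%:R : D) by case: b; [exact: tm_fil1|exact: tm_fil0].
have fM (x y : D) : tm_fil 1 x -> tm_fil 1 y -> tm_fil 1 (x * y) by apply: tm_filM.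
by do ![apply: tm_filD | apply: (fM) | apply: (fq) | apply: (fX) | apply: (fZ)].
Qed.

Lemma residue_eps (s : T) : (forall u, tm_eps (varX u) = false) ->
  (forall u, tm_eps (varZ u) = false) -> s pu = false -> tm_eps (residue s) = false.
Proof.
move=> eX eZ su.
by rewrite /residue su /linX /linZ /quadXZ !(tm_epsD, tm_epsM, eX, eZ, andbF, tm_eps0).
Qed.

Lemma residue_basis k : residue (gor_basis (pv k)) =
  (val k == 0%N)%:R * varX true + (val k == 1%N)%:R * varX false
  + ((val k == 2)%:R * varZ true + (val k == 3)%:R * varZ false).
Proof.
have Ev i : gor_basis (pv k) (pv i) = (i == k) by rewrite gor_basisE.
have Ed i : gor_basis (pv k) (pd i) = false by rewrite gor_basisE.
have Eu : (gor_basis (pv k) : T) pu = false by rewrite gor_basisE.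
rewrite /residue /linX /linZ /quadXZ !Ev !Ed Eu !mulr0n !mul0r !addr0 !mul0r !addr0.
by rewrite add0r -!val_eqE /= ![_ == val k]eq_sym.
Qed.

End Residue.

(** * The Tate resolution over T and the two chains *)

Definition inner_model : tate_model := step_model bool_model.
(** The inner step adjoins the letters Z, the outer one the letters X. *)
Definition outer_model : tate_model := step_model inner_model.

Section Chains.
Variables n e : nat.
Hypothesis n8 : (8 <= n)%N.
Local Notation T := (gor bool n e).
Local Notation D := outer_model.

Definition varX (u : bool) : D := step_var inner_model u.
Definition varZ (u : bool) : D := @step_lift inner_model (step_var bool_model u).

Lemma varXX u v : varX u * varX v = 0. Proof. exact: step_varM. Qed.
Lemma varZZ u v : varZ u * varZ v = 0.
Proof. by rewrite -step_liftM step_varM step_lift0. Qed.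

Lemma varX_fil u : tm_fil 1 (varX u). Proof. exact: step_fil_var. Qed.
Lemma varZ_fil u : tm_fil 1 (varZ u).
Proof. by apply: step_fil_lift; apply: step_fil_var. Qed.
Lemma varX_eps u : tm_eps (varX u) = false. Proof. exact: step_eps_var. Qed.
Lemma varZ_eps u : tm_eps (varZ u) = false. Proof. exact: step_eps_var. Qed.

Definition iota_gor : T -> D := residue n8 varX varZ.

(** The word x_1 ... x_1 x_2 with k letters; its right end x_2 is what makes (ad x_1)^n x_2 take the
    value 1 on the word of length n + 1. *)
Definition chain_word k : seq bool :=
  if k is j.+1 then rcons (nseq j true) false else [::].

Lemma chain_wordS k : chain_word k.+1 = (k != 0%N) :: chain_word k.
Proof. by case: k. Qed.

Lemma size_chain_word k : size (chain_word k) = k.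
Proof. by case: k => //= k; rewrite size_rcons size_nseq. Qed.

(** Words grow on the left, so stage 0 uses x_2 and every later stage x_1. *)
Definition chainX k : T := gor_basis (pv (
  if k is 0%N then ix n8 (isT : (1 < 8)%N) else ix n8 (isT : (0 < 8)%N))).
Definition chainZ k : T := gor_basis (pv (
  if k is 0%N then ix n8 (isT : (3 < 8)%N) else ix n8 (isT : (2 < 8)%N))).

Lemma iota_chainX k : iota_gor (chainX k) = varX (k != 0%N).
Proof.
case: k => [|k]; rewrite /iota_gor residue_basis /= !mulr0n !mulr1n;
  by rewrite !mul0r !mul1r ?addr0 ?add0r.
Qed.

Lemma iota_chainZ k : iota_gor (chainZ k) = varZ (k != 0%N).
Proof.
case: k => [|k]; rewrite /iota_gor residue_basis /= !mulr0n !mulr1n;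
  by rewrite !mul0r !mul1r ?addr0 ?add0r.
Qed.

Lemma tate_chainX : tate_chain (@gor_max n e) iota_gor chainX
  (fun k => word inner_model (chain_word k)).
Proof.
split.
- exact: word_nil.
- by move=> k; rewrite chain_wordS iota_chainX; apply: step_d_word.
- by move=> k; rewrite -{1}(size_chain_word k); apply: step_fil_word.
- by move=> k; rewrite step_eps_word chain_wordS.
split=> k; first by rewrite /gor_max /= gor_basisE.
(* No monomial of the cubic form contains two factors from X, so the consecutive product is 0. *)
apply/ffunP => p; rewrite gor_basis_mulvv ffunE.
by case: p => // p; case: k => [|k] /=; move: (nat_of_ord p) => [|[|[|[|[|[|[|[|r]]]]]]]].
Qed.

Lemma tate_chainZ : tate_chain (@gor_max n e) iota_gor chainZ
  (fun k => @step_lift inner_model (word bool_model (chain_word k))).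
Proof.
split.
- by rewrite -step_lift1 -word_nil.
- move=> k; rewrite chain_wordS iota_chainZ step_d_lift -step_liftM; congr step_lift.
  exact: step_d_word.
- by move=> k; rewrite -{1}(size_chain_word k); apply: step_fil_lift; apply: step_fil_word.
- by move=> k; rewrite step_eps_lift step_eps_word chain_wordS.
split=> k; first by rewrite /gor_max /= gor_basisE.
apply/ffunP => p; rewrite gor_basis_mulvv ffunE.
by case: p => // p; case: k => [|k] /=; move: (nat_of_ord p) => [|[|[|[|[|[|[|[|r]]]]]]]].
Qed.

Lemma gor_not_generalized_golod : ~ generalized_golod (@gor_max n e).
Proof.
move=> [q [q0 [A [N [deg [X [hPAC hG]]]]]]].
have iD (r s : T) : iota_gor (r + s) = iota_gor r + iota_gor s by apply: residueD.
have iM (r s : T) : iota_gor (r * s) = iota_gor r * iota_gor s.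
  by apply: residueM; [exact: varXX|exact: varZZ].
have i1 : iota_gor 1 = 1 by apply: residue1.
have ifil (s : T) : tm_fil 1 (iota_gor s).
  by apply: residue_fil; [exact: varX_fil|exact: varZ_fil].
have ieps (s : T) : gor_max s -> tm_eps (iota_gor s) = false.
  by apply: residue_eps; [exact: varX_eps|exact: varZ_eps].
have [f [fD fZ fM f1 [fd ffil feps fchain]]] :=
  comparison_map (@gor_two n e) hPAC iD iM i1 ifil ieps.
(* The derivation a strips letters X from words; b strips letters Z inside the coefficients. *)
have ha := @chain_derivation_ad_rstrip inner_model q.
have hb := chain_derivation_map (@chain_derivation_ad_rstrip bool_model q).
apply: (not_golod (@gor_two n e) iD iM ifil ieps hPAC fZ f1 fd ffil feps q0
  tate_chainX tate_chainZ ha hb _ _ _ _ fD fM fchain hG).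
- by move=> u; apply: ad_rstrip_map; have [[]] := @chain_derivation_ad_rstrip bool_model q.
- by rewrite /chain_word -[X in nseq X](addn0 q) ad_rstrip_word step_eps_word.
- rewrite shuf_map_word ?tm_eps0 //.
  by have [] := @chain_derivation_ad_rstrip bool_model q.
- rewrite shuf_map_lift; last exact: ad_rstrip0.
  by rewrite step_eps_lift /chain_word -[X in nseq X](addn0 q) ad_rstrip_word step_eps_word.
Qed.

End Chains.

Theorem theorem4 :
  (forall n : nat, (8 <= n)%N ->
     exists (S : comNzRingType) (m : set S),
       artinian_gorenstein_local m /\
       has_hvector m [:: 1; n; n; 1]%N /\
       ~ generalized_golod m) /\
  (forall l : nat, (18 <= l)%N ->
     exists (S : comNzRingType) (m : set S),
       artinian_gorenstein_local m /\
       has_length S l /\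
       ~ generalized_golod m).
Proof.
split=> [n n8|l l18].
  exists (gor bool n 0), (@gor_max n 0); split; first exact: gor_artinian_gorenstein.
  by split; [exact: gor_hvector|exact: gor_not_generalized_golod].
(* The length is 2 * 8 + e + 2 = 18 + e, so e = l - 18 additional squares give every l from 18 on,
   of either parity. *)
exists (gor bool 8 (l - 18)), (@gor_max 8 (l - 18)); split.
  exact: gor_artinian_gorenstein.
split; last exact: gor_not_generalized_golod.
by have := gor_length 8 (l - 18); rewrite (_ : 2 * 8 + (l - 18) + 2 = l)%N //; lia.
Qed.
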